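(* Let $\alpha:=m/n^{1/3}$. As $n\to\infty$, $$\frac{\log H_{n,m}}{n^{2/3}}\sim H(\alpha):=r+r^{-2}\eta(\alpha r),$$ uniformly as $m\to\infty$ and $m\le n$, where $r=r(\alpha)>0$ solves the equation $$r^3-2\eta(\alpha r)+\alpha r\,\eta'(\alpha r)=0.$$ In particular, $$H(\alpha)\sim\begin{cases}\dfrac{2\pi}{\sqrt6}\,\sqrt\alpha,&\text{if }\alpha\to0;\\[2mm] 3\cdot2^{-2/3}\zeta(3)^{1/3},&\text{if }\alpha\to\infty.\end{cases}$$
   Context: $H_{n,m}$ denotes the number of $m$-rowed plane partitions of $n$, i.e. plane partitions of $n$ (arrays of nonnegative integers, nonincreasing along rows and columns, with sum $n$) with at most $m$ nonzero rows; it is known that $$\sum_{n\ge0}H_{n,m}z^n=\prod_{k\ge1}\bigl(1-z^k\bigr)^{-\min\{k,m\}}.$$ For $t\ge0$, $\eta(t):=\sum_{j\ge1}\frac{1-e^{-jt}}{j^3}$. $\zeta$ is the Riemann zeta function. *)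

(* Defs.v *)
From HB Require Import structures.
From mathcomp Require Import all_boot all_order all_algebra.
From mathcomp Require Import all_classical all_reals all_analysis.
Import Order.TTheory GRing.Theory Num.Theory.
Import numFieldNormedType.Exports.

Set Implicit Arguments.
Unset Strict Implicit.
Unset Printing Implicit Defensive.

Local Open Scope ring_scope.

(* A plane partition of n has at most n nonzero rows, at most n nonzero
   columns, and parts at most n; so every plane partition of n is represented,
   exactly once, by its n x n top left corner with entries in {0, ..., n}. *)
Definition is_plane_partition (n : nat) (A : 'M['I_n.+1]_n) : bool :=
  [&& [forall i : 'I_n, forall j : 'I_n, forall k : 'I_n,
         (j <= k)%N ==> (A i k <= A i j)%N],
      [forall j : 'I_n, forall i : 'I_n, forall k : 'I_n,
         (i <= k)%N ==> (A k j <= A i j)%N]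
    & (\sum_(i < n) \sum_(j < n) (A i j : nat))%N == n].

Definition nonzero_rows (n : nat) (A : 'M['I_n.+1]_n) : nat :=
  #|[pred i : 'I_n | [exists j : 'I_n, (A i j : nat) != 0%N]]|.

Definition plane_partitions (n m : nat) : nat :=
  #|[pred A : 'M['I_n.+1]_n |
      is_plane_partition A && (nonzero_rows A <= m)%N]|.

Section Functions.
Context {R : realType}.

Definition eta (t : R) : R :=
  limn (series (fun j : nat => (1 - expR (- (j.+1%:R * t))) / j.+1%:R ^+ 3)).

(* The Riemann zeta function on the real half-line s > 1. *)
Definition zeta (s : R) : R := limn (series (riemannR s)).

Definition saddle_point (a x : R) : Prop :=
  0 < x /\ x ^+ 3 - 2 * eta (a * x) + a * x * derive1 eta (a * x) = 0.

Definition growth (r : R -> R) (a : R) : R :=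
  r a + r a ^- 2 * eta (a * r a).

End Functions.

(* Main.v *)
From Pilot Require Import Defs.
From HB Require Import structures.
From mathcomp Require Import all_boot all_order all_algebra.
From mathcomp Require Import all_classical all_reals all_analysis.
From mathcomp Require Import ring lra zify.
Import Order.TTheory GRing.Theory Num.Theory.
Import numFieldNormedType.Exports.

(** Why the theorem holds.

    Counting. A growth diagram built from the local moves of the
    Robinson-Schensted-Knuth correspondence identifies plane partitions of n
    with at most m rows with m x n arrays of natural numbers of weight n, where
    an entry is weighted by the hook length of its box ([plane_partitionsE]).
    So their generating function at z = exp (- tau) is the product F(tau) of
    the factors 1 / (1 - exp (- h tau)) over the hook lengths h.

    The generating function. Expanding the logarithms and summing over the
    boxes, ln F(tau) becomes a series over l whose l-th term contains
    1 - exp (- l m tau) divided by 4 l sinh^2 (l tau / 2). As sinh u >= u, it is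
    at most eta (m tau) / tau^2, and this is sharp up to a relative error that
    tends to 0 with tau, uniformly in m ([ln_box_prod_le], [ln_box_prod_ge]).

    Upper bound. H_{n,m} <= exp (tau n) F(tau) for every tau > 0. Taking
    tau = r / n^(1/3) bounds ln H_{n,m} by n^(2/3) (r + eta (alpha r) / r^2),
    without any error term. The saddle point equation says that r is the
    stationary point of this exponent.

    Lower bound. At a slightly larger parameter (1 + d) tau, the sum F
    is concentrated on sizes between (1 - 9 d) n and n: what lies outside is
    compared with F at tau and at (1 + 2 d) tau. The gain is of order d^2 in
    the exponent because x |-> eta (a x) / x^2 is convex in 1 / x
    ([eta_scale]) while eta lies below its tangents ([eta_tangent]). The sizes
    in the window contribute at most (n + 1) H_{n,m} terms, because the counts
    are nondecreasing in the size. All these inequalities are homogeneous in r,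
    and r n^(2/3) >= sqrt n / 2, so the estimate is uniform in m
    ([uniform_bound]).

    The saddle point. With psi (t) = 2 eta (t) - t eta' (t) the equation is
    x^3 = psi (a x); it has a solution by continuity, and only one because
    psi (t) / t^2 is nonincreasing ([psi_sqr]).

    The two limits. For small a, eta (t) = zeta(2) t + O(t^(3/2)) and the
    exponent is close to x + zeta(2) a / x, with minimum 2 sqrt (zeta(2) a);
    zeta(2) = pi^2 / 6 is obtained by repeated halving of angles in sums of
    squared cosecants ([basel]). For large a, eta (t) tends to zeta(3) and the
    exponent is close to x + zeta(3) / x^2. *)

Set Implicit Arguments.
Unset Strict Implicit.
Unset Printing Implicit Defensive.

Local Open Scope classical_set_scope.

(** * Growth diagrams of interlacing partitions *)

(** The relation usually written mu < lambda with a curly sign: la is mu with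
    a horizontal strip added, both partitions being read as infinite sequences
    of parts. *)
Definition interlace (mu la : nat -> nat) : Prop :=
  forall a, (mu a <= la a)%N /\ (la a.+1 <= mu a)%N.

(** The piecewise-linear local move. Apart from the first part, which absorbs
    the free number k, each part is reflected in the interval that the two
    neighbours mu and nu allow for it, so the move can be undone, and the
    sizes satisfy |toggle| + |kappa| = |mu| + |nu| + k. *)
Definition toggle (kappa mu nu : nat -> nat) (k a : nat) : nat :=
  if a is b.+1
  then (maxn (mu a) (nu a) + minn (mu b) (nu b) - kappa b)%N
  else (maxn (mu 0) (nu 0) + k)%N.

Lemma interlace_toggle kappa mu nu k :
  interlace kappa mu -> interlace kappa nu ->
  interlace mu (toggle kappa mu nu k) /\ interlace nu (toggle kappa mu nu k).
Proof.
move=> km kn; split=> -[|a]; rewrite /toggle /=.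
- by have := km 0; have := kn 0; lia.
- by have := km a; have := kn a; have := km a.+1; have := kn a.+1; lia.
- by have := km 0; have := kn 0; lia.
- by have := km a; have := kn a; have := km a.+1; have := kn a.+1; lia.
Qed.

Lemma toggleK kappa mu nu k a :
  interlace kappa mu -> interlace kappa nu ->
  kappa a = (maxn (mu a.+1) (nu a.+1) + minn (mu a) (nu a)
             - toggle kappa mu nu k a.+1)%N.
Proof. by move=> km kn; have := km a; have := kn a; rewrite /toggle; lia. Qed.

(** Undoing the local move: kappa is obtained by the same reflection, and k is
    the excess of the first part of la over those of mu and nu. *)
Lemma toggle_ex mu nu la :
  interlace mu la -> interlace nu la ->
  exists kappa k, [/\ interlace kappa mu, interlace kappa nu
                    & la = toggle kappa mu nu k].
Proof.
move=> ml nl.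
exists (fun a => maxn (mu a.+1) (nu a.+1) + minn (mu a) (nu a) - la a.+1)%N.
exists (la 0 - maxn (mu 0) (nu 0))%N; split.
- by move=> a; have := ml a; have := nl a; have := ml a.+1; have := nl a.+1;
  lia.
- by move=> a; have := ml a; have := nl a; have := ml a.+1; have := nl a.+1;
  lia.
apply/funext => -[|a]; rewrite /toggle; first by have := ml 0; have := nl 0;
  lia.
by have := ml a; have := nl a; have := ml a.+1; have := nl a.+1; lia.
Qed.

Fixpoint diagram_row (prev : nat -> nat -> nat) (k : nat -> nat) (j : nat) :
    nat -> nat :=
  if j is j'.+1
  then toggle (prev j') (prev j) (diagram_row prev k j') (k j')
  else fun=> 0%N.

(** The partitions of the growth diagram of the array k: the partition at the
    point (i, j) is determined by the i x j upper left corner of k. This is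
    the Robinson-Schensted-Knuth correspondence in the form of local rules. *)
Fixpoint diagram (k : nat -> nat -> nat) (i : nat) : nat -> nat -> nat :=
  if i is i'.+1 then diagram_row (diagram k i') (k i') else fun _ _ => 0%N.

Lemma diagramSS k i j :
  diagram k i.+1 j.+1 =
  toggle (diagram k i j) (diagram k i j.+1) (diagram k i.+1 j) (k i j).
Proof. by []. Qed.

Lemma diagram0 k i : diagram k i 0 = fun=> 0%N.
Proof. by case: i. Qed.

Arguments diagram : simpl never.

(** The local move turns interlacing on the two lower sides of a unit square
    into interlacing on the two upper sides, so it spreads along a row from
    left to right. *)
Lemma diagram_interlace_aux k i :
  (forall j, interlace (diagram k i j) (diagram k i j.+1)) ->
  forall j, interlace (diagram k i j) (diagram k i.+1 j) /\
            interlace (diagram k i.+1 j) (diagram k i.+1 j.+1).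
Proof.
move=> H; elim=> [|j [IH1 _]].
  have h0 : interlace (diagram k i 0) (diagram k i.+1 0).
    by rewrite !diagram0.
  by split=> //; have [] := interlace_toggle (k i 0) (H 0) h0.
have [h1 h2] := interlace_toggle (k i j) (H j) IH1.
by split=> //; have [] := interlace_toggle (k i j.+1) (H j.+1) h1.
Qed.

Lemma diagram_interlace_r k i j :
  interlace (diagram k i j) (diagram k i j.+1).
Proof.
elim: i j => [//|i IH] j.
by have [] := diagram_interlace_aux IH j.
Qed.

Lemma diagram_interlace_l k i j :
  interlace (diagram k i j) (diagram k i.+1 j).
Proof. by have [] := diagram_interlace_aux (diagram_interlace_r k i) j. Qed.

(** The partition at height i has at most i parts because each step up adds
    one horizontal strip. *)
Lemma diagram_support_l k i j a : (i <= a)%N -> diagram k i j a = 0%N.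
Proof.
elim: i a => [//|i IH] [//|a] ia.
by have [_] := diagram_interlace_l k i j a; rewrite (IH a) //; lia.
Qed.

Lemma diagram_support_r k i j a : (j <= a)%N -> diagram k i j a = 0%N.
Proof.
elim: j a => [|j IH] a; first by rewrite diagram0.
case: a => // a ja.
by have [_] := diagram_interlace_r k i j a; rewrite (IH a) //; lia.
Qed.

(** The reflection replaces kappa by max + min - kappa, and max + min = mu +
    nu; the maxima and the minima pair up after a shift of the index by one,
    which is why the last part of mu has to vanish. *)
Lemma sum_toggle kappa mu nu k b :
  interlace kappa mu -> interlace kappa nu ->
  kappa b = 0%N -> mu b = 0%N ->
  (\sum_(a < b.+1) toggle kappa mu nu k a + \sum_(a < b.+1) kappa a =
   k + \sum_(a < b.+1) mu a + \sum_(a < b.+1) nu a)%N.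
Proof.
move=> km kn kb mb.
rewrite big_ord_recl (big_ord_recr b kappa) /= kb addn0 -addnA -big_split /=.
rewrite (eq_bigr (fun i : 'I_b => maxn (mu i.+1) (nu i.+1)
                                  + minn (mu i) (nu i))%N); last first.
  move=> i _; have := km i; have := kn i;
    rewrite /toggle /bump leq0n add1n /= !add0n; lia.
rewrite big_split /=.
have hmin : (\sum_(i < b.+1) minn (mu i) (nu i) =
             \sum_(i < b) minn (mu i) (nu i))%N.
  by rewrite big_ord_recr /= mb min0n addn0.
have hmax : (\sum_(i < b.+1) maxn (mu i) (nu i) =
             maxn (mu 0) (nu 0) + \sum_(i < b) maxn (mu i.+1) (nu i.+1))%N.
  by rewrite big_ord_recl.
have hsum : (\sum_(i < b.+1) maxn (mu i) (nu i)
             + \sum_(i < b.+1) minn (mu i) (nu i) =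
             \sum_(i < b.+1) mu i + \sum_(i < b.+1) nu i)%N.
  by rewrite -!big_split; apply: eq_bigr => i _ /=; lia.
by move: hsum; rewrite hmin hmax /toggle => h;
  rewrite -(addnA k) -h (addnC _ k) -!addnA.
Qed.

(** By the conservation law of the local move, sizes satisfy the recurrence of
    rectangular partial sums. *)
Lemma sum_diagram k b i j : (i <= b)%N ->
  (\sum_(a < b) diagram k i j a = \sum_(s < i) \sum_(t < j) k s t)%N.
Proof.
case: b => [|b]; first by case: i => // _; rewrite !big_ord0.
elim: i j => [|i IH] j ib; first by rewrite big_ord0 big1.
rewrite [RHS]big_ord_recr /= -IH; last by lia.
elim: j => [|j IHj]; first by rewrite !diagram0 big_ord0 addn0.
have := @sum_toggle _ _ _ (k i j) b (diagram_interlace_r k i j)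
  (diagram_interlace_l k i j).
rewrite -diagramSS !diagram_support_l //; try lia.
move/(_ erefl erefl);
  rewrite IHj (big_ord_recr j (fun t : 'I_j.+1 => k i t)) /=.
by lia.
Qed.

(** The local move is invertible, so the partitions on the upper and right
    sides of the rectangle determine all the others from the far corner
    downwards, and then the array. *)
Lemma diagram_inj k k' m n :
  (forall j, (j <= n)%N -> diagram k m j = diagram k' m j) ->
  (forall i, (i <= m)%N -> diagram k i n = diagram k' i n) ->
  forall i j, (i < m)%N -> (j < n)%N -> k i j = k' i j.
Proof.
move=> Hm Hn.
have key i j : (i <= m)%N -> (j <= n)%N -> diagram k i j = diagram k' i j.
  move=> im; have [d ->] : exists d, i = (m - d)%N by exists (m - i)%N; lia.
  elim: d j {i im} => [|d IHd] j jn; first by rewrite subn0 Hm.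
  have [md|md] := leqP m d.
    have -> : (m - d.+1 = m - d)%N by lia.
    exact: IHd.
  have [e ->] : exists e, j = (n - e)%N by exists (n - j)%N; lia.
  elim: e {j jn} => [|e IHe]; first by rewrite subn0 Hn //; lia.
  have [ne|ne] := leqP n e.
    by have -> : (n - e.+1 = n - e)%N by lia.
  set i := (m - d.+1)%N in IHe *; set j := (n - e.+1)%N.
  have Ei : (m - d = i.+1)%N by rewrite /i; lia.
  have Ej : (n - e = j.+1)%N by rewrite /j; lia.
  rewrite Ej in IHe; rewrite Ei in IHd.
  apply/funext => a.
  rewrite (toggleK (k i j) _ (diagram_interlace_r k i j) (diagram_interlace_l
    k i j)).
  rewrite [RHS](toggleK (k' i j) _ (diagram_interlace_r k' i j)
     (diagram_interlace_l k' i j)).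
  by rewrite -!diagramSS IHe !IHd //; rewrite /j; lia.
move=> i j im jn.
have := f_equal (@^~ 0%N) (key i.+1 j.+1 im jn).
rewrite !diagramSS /toggle !key //; lia.
Qed.

Lemma diagram_ext k k' i j :
  (forall s t, (s < i)%N -> (t < j)%N -> k s t = k' s t) ->
  diagram k i j = diagram k' i j.
Proof.
elim: i j => [//|i IH]; elim=> [|j IHj] H; first by rewrite !diagram0.
rewrite !diagramSS H // !IH; first 1 last.
- by move=> s t si tj; apply: H; lia.
- by move=> s t si tj; apply: H; lia.
by rewrite IHj // => s t si tj; apply: H; lia.
Qed.

(** One row of unit squares is undone from right to left; the result is the
    top boundary of the diagram with one row less. *)
Lemma row_down n (P : nat -> nat -> nat) (q : nat -> nat) :
  (forall j, (j < n)%N -> interlace (P j) (P j.+1)) -> interlace q (P n) ->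
  exists P' k,
  [/\ P' n = q,
      forall j, (j <= n)%N -> interlace (P' j) (P j),
      forall j, (j < n)%N -> interlace (P' j) (P' j.+1)
    & forall j, (j < n)%N -> P j.+1 = toggle (P' j) (P' j.+1) (P j) (k j)].
Proof.
elim: n q => [|n IH] q HP qP.
  exists (fun=> q), (fun=> 0%N); split=> // j.
  by rewrite leqn0 => /eqP ->.
have [kappa [k0 [kq kP E]]] := toggle_ex qP (HP n (ltnSn n)).
have [j jn|P' [k [P'n H1 H2 H3]]] := IH kappa _ kP.
  by apply: HP; lia.
exists (fun j => if j == n.+1 then q else P' j),
       (fun j => if j == n then k0 else k j); split.
- by rewrite eqxx.
- move=> j jn; case: (eqVneq j n.+1) => [->//|jn'].
  by apply: H1; lia.
- move=> j jn; rewrite eqSS; have -> : (j == n.+1) = false by lia.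
  case: (eqVneq j n) => [->|jn']; first by rewrite P'n.
  by apply: H2; lia.
- move=> j jn; rewrite eqSS; have -> : (j == n.+1) = false by lia.
  case: (eqVneq j n) => [->|jn']; first by rewrite P'n.
  by apply: H3; lia.
Qed.

(** Every pair of interlacing chains that start from the empty partition and
    share their last member occurs as the boundary of a growth diagram: undo
    the rows one after the other. *)
Lemma diagram_surj m n (P Q : nat -> nat -> nat) :
  P 0 = (fun=> 0%N) -> Q 0 = (fun=> 0%N) -> P n = Q m ->
  (forall j, (j < n)%N -> interlace (P j) (P j.+1)) ->
  (forall i, (i < m)%N -> interlace (Q i) (Q i.+1)) ->
  exists k,
  (forall j, (j <= n)%N -> diagram k m j = P j) /\
  (forall i, (i <= m)%N -> diagram k i n = Q i).
Proof.
elim: m P => [|m IH] P P0 Q0 PQ HP HQ.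
  exists (fun _ _ => 0%N); split=> [j jn|i]; last first.
    by rewrite leqn0 => /eqP ->.
  apply/funext => a; change (0 = P j a)%N.
  have [d ->] : exists d, j = (n - d)%N by exists (n - j)%N; lia.
  elim: d {j jn} => [|d IHd]; first by rewrite subn0 PQ Q0.
  have [nd|nd] := leqP n d.
    by have -> : (n - d.+1 = n - d)%N by lia.
  have E : (n - d = (n - d.+1).+1)%N by lia.
  rewrite E in IHd.
  have [] := HP (n - d.+1)%N _ a; first by lia.
  by lia.
have [|P' [r [P'n H1 H2 H3]]] := @row_down n P (Q m) HP.
  by rewrite PQ; apply: HQ.
have P'0 : P' 0 = fun=> 0%N.
  apply/funext => a; have [+ _] := H1 0 (leq0n n) a.
  by rewrite P0; lia.
have [] := IH P' P'0 Q0 P'n H2 => [i im|k [Hk1 Hk2]]; first by apply: HQ; lia.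
pose k' i := if i == m then r else k i.
have kE i j : (i <= m)%N -> diagram k' i j = diagram k i j.
  move=> im; apply: diagram_ext => s t si _; rewrite /k'.
  by have -> : (s == m) = false by lia.
have top j : (j <= n)%N -> diagram k' m.+1 j = P j.
  elim: j => [|j IHj] jn; first by rewrite diagram0 P0.
  rewrite diagramSS !(kE m) // IHj; last by lia.
  by rewrite !Hk1 //; [rewrite /k' eqxx -H3|lia].
exists k'; split=> // i; rewrite leq_eqVlt => /orP[/eqP ->|im].
  by rewrite top.
by rewrite kE // Hk2.
Qed.

(** * From growth diagrams to plane partitions *)

Local Open Scope nat_scope.

Lemma diagram_pred_r k i j a : diagram k i j a.+1 <= diagram k i j.-1 a.
Proof.
by case: j => [|j]; [rewrite diagram0 | have [] := diagram_interlace_r k i j a].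
Qed.

Lemma diagram_pred_l k i j a : diagram k i j a.+1 <= diagram k i.-1 j a.
Proof. by case: i => [//|i]; have [] := diagram_interlace_l k i j a. Qed.

Lemma leq_diagram_pred_r k i j a : diagram k i j.-1 a <= diagram k i j a.
Proof. by case: j => [//|j]; have [] := diagram_interlace_r k i j a. Qed.

Lemma leq_diagram_pred_l k i j a : diagram k i.-1 j a <= diagram k i j a.
Proof. by case: i => [//|i]; have [] := diagram_interlace_l k i j a. Qed.

(** The chains on the upper and right sides of the growth diagram are read as
    the diagonals of an array: the upper side gives the diagonals on and above
    the main one, the right side those below it. Truncated subtraction merges
    the two cases into one formula. *)
Definition planar m n (k : nat -> nat -> nat) (x y : nat) : nat :=
  diagram k (m - (x - y)) (n - (y - x)) (minn x y).

Lemma planarSr m n k x y : planar m n k x y.+1 <= planar m n k x y.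
Proof.
rewrite /planar; have [xy|yx] := leqP x y.
  have -> : x - y.+1 = x - y by lia.
  have -> : n - (y.+1 - x) = (n - (y - x)).-1 by lia.
  have -> : minn x y.+1 = x by lia.
  exact: leq_diagram_pred_r.
have -> : y.+1 - x = y - x by lia.
have -> : minn x y.+1 = y.+1 by lia.
apply: leq_trans (diagram_pred_l _ _ _ _) _.
by have -> : (m - (x - y.+1)).-1 = m - (x - y) by lia.
Qed.

Lemma planarSl m n k x y : planar m n k x.+1 y <= planar m n k x y.
Proof.
rewrite /planar; have [yx|xy] := leqP y x.
  have -> : y - x.+1 = y - x by lia.
  have -> : m - (x.+1 - y) = (m - (x - y)).-1 by lia.
  have -> : minn x.+1 y = y by lia.
  exact: leq_diagram_pred_l.
have -> : x.+1 - y = x - y by lia.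
have -> : minn x.+1 y = x.+1 by lia.
apply: leq_trans (diagram_pred_r _ _ _ _) _.
by have -> : (n - (y - x.+1)).-1 = n - (y - x) by lia.
Qed.

Lemma planar_rows m n k x y : m <= x -> planar m n k x y = 0.
Proof. by move=> mx; rewrite /planar diagram_support_l //; lia. Qed.

(** The number of boundary partitions whose rectangle contains the box (i, j),
    that is, its hook length in the m x n rectangle seen from the corner
    opposite to the origin. *)
Definition box_weight m n i j := m - i + (n - j.+1).

Definition array_weight m n (k : nat -> nat -> nat) :=
  \sum_(i < m) \sum_(j < n) k i j * box_weight m n i j.

(** Summation along diagonals; entries beyond the end of a diagonal are
    supposed to vanish, which makes all diagonals equally long. *)
Lemma sum_diagonals n (F : nat -> nat -> nat) :
  (forall c a, n - c <= a -> F c a = 0) ->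
  \sum_(x < n) \sum_(y < n | x <= y) F (y - x) x =
  \sum_(c < n) \sum_(a < n) F c a.
Proof.
move=> F0; rewrite [RHS]exchange_big /=; apply: eq_bigr => x _.
rewrite -(big_mkord (fun y => x <= y) (fun y => F (y - x) x)).
rewrite -(big_mkord predT (fun c => F c x)).
have xn : x <= n by apply: ltnW.
rewrite (big_cat_nat (n := x)) //= big_nat_cond big1 ?add0n; last first.
  by move=> i /andP[/andP[_ ix]]; lia.
rewrite -[X in index_iota X n](add0n x) big_addn [RHS](big_cat_nat (n :=
  n - x)) //=; last by lia.
rewrite [X in _ = _ + X]big_nat_cond [X in _ = _ + X]big1 ?addn0; last first.
  by move=> i /andP[/andP[i1 i2] _]; rewrite F0 //; lia.
rewrite big_nat_cond [RHS]big_nat_cond.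
apply: eq_big => [i|i _]; last by rewrite addnK.
by rewrite leq_addl !andbT.
Qed.

Lemma sum_ltn_ord n b : \sum_(c < n) (c < b : nat) = minn b n.
Proof.
elim: n => [|n IH]; first by rewrite big_ord0 minn0.
by rewrite big_ord_recr /= IH; lia.
Qed.

Lemma sum_ord_widen n p (G : nat -> nat) :
  p <= n -> \sum_(j < p) G j = \sum_(j < n) (j < p) * G j.
Proof.
move=> pn; rewrite (big_ord_widen n G pn) big_mkcond.
by apply: eq_bigr => i _; case: ifP; rewrite ?mul1n ?mul0n.
Qed.

(** The size of the plane partition is the sum of the sizes of the boundary
    partitions, each of which is a rectangular sum of entries; every entry is
    then counted once for each rectangle that contains it. *)
Lemma sum_planar m n k : m <= n ->
  \sum_(x < n) \sum_(y < n) planar m n k x y = array_weight m n k.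
Proof.
move=> mn.
have -> : \sum_(x < n) \sum_(y < n) planar m n k x y =
  \sum_(x < n) \sum_(y < n | x <= y) diagram k m (n - (y - x)) x +
  \sum_(y < n) \sum_(x < n | y <= x)
     (x - y != 0) * diagram k (m - (x - y)) n y.
  under [X in _ = _ + X]eq_bigr do rewrite big_mkcond.
  rewrite [X in _ = _ + X]exchange_big -big_split; apply: eq_bigr => x _ /=.
  rewrite [X in _ = X + _]big_mkcond -big_split; apply: eq_bigr => y _ /=.
  rewrite /planar; case: (ltngtP x y) => [xy|yx|->].
  - have -> : x - y = 0 by lia.
    by rewrite subn0 addn0.
  - have -> : y - x = 0 by lia.
    have -> : x - y != 0 by lia.
    by rewrite subn0 add0n mul1n.
  - by rewrite subnn mul0n addn0 subn0.
rewrite (sum_diagonals (F := fun c x => diagram k m (n - c) x)); last first.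
  by move=> c a ca; rewrite diagram_support_r.
rewrite (sum_diagonals (F := fun c y => (c != 0) * diagram k (m - c) n y));
  last first.
  by move=> c a ca; rewrite diagram_support_l ?muln0 //; lia.
rewrite /array_weight.
have -> : \sum_(c < n) \sum_(a < n) diagram k m (n - c) a =
          \sum_(i < m) \sum_(j < n) k i j * (n - j).
  under eq_bigr => c _ do
    (rewrite sum_diagram //; under eq_bigr => i _ do
       rewrite (sum_ord_widen (k i) (leq_subr c n))).
  rewrite exchange_big; apply: eq_bigr => i _.
  rewrite exchange_big; apply: eq_bigr => j _ /=.
  rewrite -big_distrl mulnC /=; congr muln.
  rewrite -[RHS](minn_idPl (leq_subr j n)) -sum_ltn_ord.
  by apply: eq_bigr => c _; congr nat_of_bool; lia.
have -> : \sum_(c < n) \sum_(a < n) (c != 0 :> nat) * diagram k (m - c) n a =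
          \sum_(i < m) \sum_(j < n) k i j * (m - i).-1.
  under eq_bigr => c _ do rewrite -big_distrr /= sum_diagram
    ?(leq_trans (leq_subr _ _)) //
    (sum_ord_widen (fun i => \sum_(j < n) k i j) (leq_subr c m)) big_distrr.
  rewrite exchange_big; apply: eq_bigr => i _ /=.
  rewrite -[RHS]big_distrl /=.
  under eq_bigr do rewrite mulnA.
  rewrite -big_distrl mulnC /=; congr muln.
  have -> : (m - i).-1 = minn (m - i) n - (0 < n) * (0 < m - i).
    by have := ltn_ord i; lia.
  rewrite -sum_ltn_ord.
  have := ltn_ord i; case: n mn => [|n] mn im; first by lia.
  rewrite !big_ord_recl /= mul0n add0n mul1n addKn.
  by apply: eq_bigr => c _; rewrite /bump /=; lia.
rewrite -big_split; apply: eq_bigr => i _; rewrite -big_split;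
  apply: eq_bigr => j _.
rewrite /= -mulnDr /box_weight; congr muln.
by have := ltn_ord i; have := ltn_ord j; lia.
Qed.

Definition ffun_weight m n K (f : {ffun 'I_m * 'I_n -> 'I_K.+1}) : nat :=
  \sum_p f p * box_weight m n p.1 p.2.

Definition ffun_array m n K (f : {ffun 'I_m * 'I_n -> 'I_K.+1}) (i j : nat) :
    nat :=
  if insub i is Some i' then if insub j is Some j' then f (i', j') else 0
  else 0.

Lemma ffun_arrayE m n K (f : {ffun 'I_m * 'I_n -> 'I_K.+1}) (i : 'I_m)
  (j : 'I_n) : ffun_array f i j = f (i, j).
Proof. by rewrite /ffun_array !valK. Qed.

Lemma array_weightE m n K (f : {ffun 'I_m * 'I_n -> 'I_K.+1}) :
  array_weight m n (ffun_array f) = ffun_weight f.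
Proof.
rewrite /array_weight /ffun_weight pair_bigA.
by apply: eq_bigr => -[i j] _; rewrite ffun_arrayE.
Qed.

Lemma card_ltn_ord n b : #|[pred i : 'I_n | i < b]| = minn b n.
Proof.
by rewrite -sum_ltn_ord -sum1_card big_mkcond; apply: eq_bigr => i _;
  rewrite inE; case: ltnP.
Qed.

Section Corner.
Variables (n : nat) (A : 'M['I_n.+1]_n).
Hypothesis ppA : is_plane_partition A.

(** The matrix extended by zero, so that the monotonicity of its rows and
    columns holds for all indices. *)
Definition mat_array (x y : nat) : nat :=
  if insub x is Some x' then if insub y is Some y' then A x' y' else 0 else 0.

Lemma mat_arrayE (x y : 'I_n) : mat_array x y = A x y.
Proof. by rewrite /mat_array !valK. Qed.

Lemma mat_array_out x y : (n <= x) || (n <= y) -> mat_array x y = 0.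
Proof.
rewrite /mat_array => /orP[] h; last case: insubP => // x' _ _.
  by rewrite insubF //; lia.
by rewrite insubF //; lia.
Qed.

Lemma mat_arraySr x y : mat_array x y.+1 <= mat_array x y.
Proof.
have [/orP h|] := boolP ((n <= x) || (n <= y.+1)).
  by rewrite mat_array_out //; apply/orP.
rewrite negb_or -!ltnNge => /andP[xn yn].
rewrite (mat_arrayE (Ordinal xn) (Ordinal yn)).
rewrite (mat_arrayE (Ordinal xn) (Ordinal (ltnW yn)));
  case/and3P: ppA => /forallP/(_ (Ordinal xn)).
move=> /forallP/(_ (Ordinal (ltnW yn)))/forallP/(_ (Ordinal yn)) /implyP h _ _.
exact: h.
Qed.

Lemma mat_arraySl x y : mat_array x.+1 y <= mat_array x y.
Proof.
have [/orP h|] := boolP ((n <= x.+1) || (n <= y)).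
  by rewrite mat_array_out //; apply/orP.
rewrite negb_or -!ltnNge => /andP[xn yn].
rewrite (mat_arrayE (Ordinal xn) (Ordinal yn)).
rewrite (mat_arrayE (Ordinal (ltnW xn)) (Ordinal yn));
  case/and3P: ppA => _ /forallP/(_ (Ordinal yn)).
move=> /forallP/(_ (Ordinal (ltnW xn)))/forallP/(_ (Ordinal xn)) /implyP h _.
exact: h.
Qed.

(** In a plane partition the nonzero rows come first, so bounding their number
    is the same as requiring the rows from m on to vanish. *)
Lemma nonzero_rows_leqP m :
  nonzero_rows A <= m <-> forall x y : 'I_n, m <= x -> A x y = 0 :> nat.
Proof.
split=> [h x y mx|h].
  apply/eqP/negPn/negP => Axy; suff: m < nonzero_rows A by lia.
  have xn := ltn_ord x.
  apply: (@leq_trans #|[pred i : 'I_n | i < x.+1]|).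
    by rewrite card_ltn_ord; lia.
  apply: subset_leq_card; apply/fintype.subsetP => i; rewrite !inE => ix.
  apply/existsP; exists y; case/and3P: ppA => _ /forallP/(_ y).
  by move=> /forallP/(_ i)/forallP/(_ x)/implyP/(_ ix) ? _; lia.
apply: (@leq_trans #|[pred i : 'I_n | i < m]|).
  apply: subset_leq_card; apply/fintype.subsetP => i;
    rewrite !inE => /existsP[y].
  by apply: contraR; rewrite -leqNgt => mi; rewrite h.
by rewrite card_ltn_ord geq_minl.
Qed.

End Corner.

Section Bijection.
Variables (m n K : nat).
Hypotheses (mn : m <= n) (nK : n <= K).

Lemma diagram_planar_r k j a : j <= n -> a < j ->
  diagram k m j a = planar m n k a (a + (n - j)).
Proof.
move=> jn aj; rewrite /planar.
have -> : a - (a + (n - j)) = 0 by lia.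
have -> : n - (a + (n - j) - a) = j by lia.
by rewrite subn0 (minn_idPl (leq_addr _ _)).
Qed.

Lemma diagram_planar_l k i a : i <= m -> a < i ->
  diagram k i n a = planar m n k (a + (m - i)) a.
Proof.
move=> im ai; rewrite /planar.
have -> : a - (a + (m - i)) = 0 by lia.
have -> : m - (a + (m - i) - a) = i by lia.
by rewrite subn0 (minn_idPr (leq_addr _ _)).
Qed.

Definition partition_of (f : {ffun 'I_m * 'I_n -> 'I_K.+1}) : 'M['I_n.+1]_n :=
  \matrix_(x, y) inord (planar m n (ffun_array f) x y).

Lemma partition_ofE f (x y : 'I_n) : ffun_weight f = n ->
  partition_of f x y = planar m n (ffun_array f) x y :> nat.
Proof.
move=> fn; rewrite mxE inordK // ltnS -[X in _ <= X]fn -array_weightE.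
rewrite -sum_planar // (bigD1 x) //= (bigD1 y) //=.
by rewrite -addnA leq_addr.
Qed.

Lemma planar_homo_r k x y z : y <= z -> planar m n k x z <= planar m n k x y.
Proof.
move=> /subnKC <-; elim: (z - y) => [|d IH]; first by rewrite addn0.
by rewrite addnS; apply: leq_trans (planarSr _ _ _ _ _) IH.
Qed.

Lemma planar_homo_l k x y z : x <= z -> planar m n k z y <= planar m n k x y.
Proof.
move=> /subnKC <-; elim: (z - x) => [|d IH]; first by rewrite addn0.
by rewrite addnS; apply: leq_trans (planarSl _ _ _ _ _) IH.
Qed.

Lemma partition_ofP f : ffun_weight f = n ->
  is_plane_partition (partition_of f) && (nonzero_rows (partition_of f) <= m).
Proof.
move=> fn; apply/andP.
have pp : is_plane_partition (partition_of f).
  apply/and3P; split.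
  - apply/forallP => x; apply/forallP => y; apply/forallP => z; apply/implyP.
    by move=> yz; rewrite !partition_ofE //; apply: planar_homo_r.
  - apply/forallP => x; apply/forallP => y; apply/forallP => z; apply/implyP.
    by move=> yz; rewrite !partition_ofE //; apply: planar_homo_l.
  apply/eqP; rewrite -[RHS]fn -array_weightE -sum_planar //.
  by apply: eq_bigr => x _; apply: eq_bigr => y _; rewrite partition_ofE.
split=> //; apply/(nonzero_rows_leqP pp) => x y mx.
by rewrite partition_ofE // planar_rows.
Qed.

Lemma partition_of_inj :
  {in [pred f | ffun_weight f == n] &, injective partition_of}.
Proof.
move=> f g; rewrite !inE => /eqP fn /eqP gn E.
have EP x y : x < n -> y < n ->
    planar m n (ffun_array f) x y = planar m n (ffun_array g) x y.
  move=> xn yn; have := partition_ofE (Ordinal xn) (Ordinal yn) fn.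
  by rewrite E partition_ofE //= => ->.
apply/ffunP => -[i j]; apply/val_inj; rewrite /= -!ffun_arrayE.
apply: (@diagram_inj _ _ m n) => // [{}j jn|{}i im]; apply/funext => a.
  have [ja|aj] := leqP j a; first by rewrite !diagram_support_r.
  by rewrite !diagram_planar_r // EP //; lia.
have [ia|ai] := leqP i a; first by rewrite !diagram_support_l.
by rewrite !diagram_planar_l // EP //; lia.
Qed.

(** The diagonals of a plane partition are interlacing chains, to which
    [diagram_surj] applies; that the entries of the resulting array fit below
    K follows from the weight identity, all weights being positive. *)
Lemma partition_of_surj (A : 'M['I_n.+1]_n) :
  is_plane_partition A -> nonzero_rows A <= m ->
  exists2 f, ffun_weight f = n & partition_of f = A.
Proof.
move=> ppA /(nonzero_rows_leqP ppA) Am.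
have A0 x y : m <= x -> mat_array A x y = 0.
  move=> mx; have [h|] := boolP ((n <= x) || (n <= y)).
    exact: mat_array_out.
  rewrite negb_or -!ltnNge => /andP[xn yn].
  by rewrite (mat_arrayE A (Ordinal xn) (Ordinal yn)) Am.
have [||||| k [Hk1 Hk2]] := @diagram_surj m n
  (fun j a => mat_array A a (a + (n - j)))
  (fun i a => mat_array A (a + (m - i)) a).
- by apply/funext => a; rewrite mat_array_out // subn0 leq_addl orbT.
- by apply/funext => a; rewrite A0 // subn0 leq_addl.
- by apply/funext => a /=; rewrite !subnn !addn0.
- move=> j jn a; have E : n - j = (n - j.+1).+1 by lia.
  by rewrite E !addnS; split; [exact: mat_arraySr | exact: mat_arraySl].
- move=> j jn a; have E : m - j = (m - j.+1).+1 by lia.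
  by rewrite E !addnS; split; [exact: mat_arraySl | exact: mat_arraySr].
have kA x y : y < n -> planar m n k x y = mat_array A x y.
  move=> yn; rewrite /planar; have [xy|yx] := leqP x y.
    have -> : x - y = 0 by lia.
    by rewrite subn0 Hk1 ?leq_subr //; congr mat_array; lia.
  have -> : y - x = 0 by lia.
  rewrite subn0 Hk2 ?leq_subr //; have [xm|mx] := leqP (x - y) m.
    by congr mat_array; lia.
  by rewrite !A0 //; lia.
have kn : array_weight m n k = n.
  rewrite -sum_planar //; case/and3P: ppA => _ _ /eqP sA; rewrite -[RHS]sA.
  by apply: eq_bigr => x _; apply: eq_bigr => y _; rewrite kA // mat_arrayE.
have kK i j : i < m -> j < n -> k i j <= K.
  move=> im jn; apply: leq_trans nK; rewrite -[X in _ <= X]kn.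
  rewrite /array_weight (bigD1 (Ordinal im)) //= (bigD1 (Ordinal jn)) //=.
  rewrite -!addnA; apply: leq_trans (leq_addr _ _).
  by rewrite leq_pmulr // /box_weight; lia.
pose f := [ffun p : 'I_m * 'I_n => inord (k p.1 p.2) : 'I_K.+1].
have fk i j : i < m -> j < n -> ffun_array f i j = k i j.
  move=> im jn; rewrite -[i]/(val (Ordinal im)) -[j]/(val (Ordinal jn)).
  by rewrite ffun_arrayE ffunE inordK // ltnS; apply: kK.
have fn : ffun_weight f = n.
  rewrite -array_weightE -[RHS]kn.
  by apply: eq_bigr => i _; apply: eq_bigr => j _; rewrite fk.
exists f => //; apply/matrixP => x y; apply/val_inj.
rewrite /= partition_ofE // -mat_arrayE -kA // /planar.
rewrite (@diagram_ext _ k) // => s t sm tn.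
by apply: fk; [apply: leq_trans sm _|apply: leq_trans tn _]; exact: leq_subr.
Qed.

(** MacMahon's theorem for plane partitions with at most m rows, in bijective
    form: arrays weighted by hook lengths are counted instead. The bound K on
    the entries is free above n, because an entry of an array of weight n is
    at most n. *)
Lemma plane_partitionsE : plane_partitions n m =
  #|[pred f : {ffun 'I_m * 'I_n -> 'I_K.+1} | ffun_weight f == n]|.
Proof.
rewrite -(card_in_imset partition_of_inj); apply: eq_card => A; rewrite !inE.
apply/idP/imsetP => [/andP[ppA rA]|[f + ->]].
  have [f fn <-] := partition_of_surj ppA rA.
  by exists f; rewrite // inE fn.
by rewrite inE => /eqP; apply: partition_ofP.
Qed.

End Bijection.

Local Open Scope classical_set_scope.
Local Open Scope ring_scope.

(** * Inequalities for the exponential *)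

(** Monotonicity from the sign of the derivative, with the derivative given
    explicitly. *)
Lemma ge0_is_derive_le (R : realType) (f df : R -> R) (a b : R) : a <= b ->
  (forall x, a <= x <= b -> is_derive x 1 f (df x)) ->
  (forall x, a <= x <= b -> 0 <= df x) -> f a <= f b.
Proof.
move=> ab fd df0.
have [||c cab /eqP] := @MVT_segment R f df a b ab.
- by move=> x; rewrite in_itv /= => /andP[/ltW ax /ltW xb]; apply: fd;
  rewrite ax.
- apply: derivable_within_continuous => x; rewrite in_itv /= => xab.
  by have [] := fd x xab.
rewrite subr_eq => /eqP ->; rewrite lerDr mulr_ge0 ?subr_ge0 //.
by apply: df0; move: cab; rewrite in_itv.
Qed.

Section ExpBounds.
Variable R : realType.
Implicit Types x t : R.

Lemma expR_ge1DxD2 x : 0 <= x -> 1 + x + x ^+ 2 / 2 <= expR x.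
Proof.
move=> x0.
pose f y : R := expR y - (1 + y + y ^+ 2 / 2).
have : f 0 <= f x.
  apply: (@ge0_is_derive_le R f (fun y => expR y - (1 + y))) =>
    // y /andP[y0 _].
    rewrite /f; apply: is_derive_eq.
    by rewrite /GRing.scale /=; field.
  by rewrite subr_ge0 expR_ge1Dx.
by rewrite /f expR0; lra.
Qed.

Lemma expRN_le1 x : 0 <= x -> expR (- x) <= 1.
Proof. by move=> x0; rewrite expR_le1 oppr_le0. Qed.

Lemma onesubexpRN_ge0 x : 0 <= x -> 0 <= 1 - expR (- x).
Proof. by move=> x0; rewrite subr_ge0 expRN_le1. Qed.

Lemma onesubexpRN_le x : 1 - expR (- x) <= x.
Proof. by have := expR_ge1Dx (- x); lra. Qed.

Lemma onesubexpRN_ge x : 0 <= x -> x - x ^+ 2 / 2 <= 1 - expR (- x).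
Proof.
move=> x0; have h := expR_ge1DxD2 x0; have e0 := expR_gt0 (- x).
have ee : expR x * expR (- x) = 1 by rewrite -expRD subrr expR0.
suff : expR (- x) <= 1 - x + x ^+ 2 / 2 by lra.
have h2 : (1 + x + x ^+ 2 / 2) * expR (- x)
  <= 1 by rewrite -[leRHS]ee ler_wpM2r // ltW.
have p0 : 0 < 1 + x + x ^+ 2 / 2 by nra.
rewrite -(ler_pM2l p0); apply: le_trans h2 _.
have -> : (1 + x + x ^+ 2 / 2) * (1 - x + x ^+ 2 / 2) = 1 + (x ^+ 2) ^+ 2 / 4.
  by field.
by rewrite lerDl divr_ge0 ?sqr_ge0 ?ler0n.
Qed.

(** Interpolates between the bounds 1 and x; the exponent 1/2 costs only half
    a power of j in the series over j. *)
Lemma onesubexpRN_le_sqrt x : 0 <= x -> 1 - expR (- x) <= Num.sqrt x.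
Proof.
move=> x0; have [x1|x1] := leP x 1.
  apply: le_trans (onesubexpRN_le x) _.
  have s0 := sqrtr_ge0 x;
    have s1 : Num.sqrt x <= 1 by rewrite -sqrtr1 ler_wsqrtr.
  by rewrite -{1}(sqr_sqrtr x0) expr2; apply: ler_piMr.
have : 1 <= Num.sqrt x by rewrite -{1}sqrtr1 ler_wsqrtr // ltW.
by have := expR_ge0 (- x); lra.
Qed.

Lemma expRN_sub_lin_le x : 0 <= x -> expR (- x) - 1 + x <= x * Num.sqrt x.
Proof.
move=> x0; have s0 := sqrtr_ge0 x; have [x1|x1] := leP x 1.
  have := onesubexpRN_ge x0.
  have s1 : Num.sqrt x <= 1 by rewrite -sqrtr1 ler_wsqrtr.
  have : x * x <= x * Num.sqrt x.
    rewrite ler_wpM2l // -{1}(sqr_sqrtr x0) expr2; exact: ler_piMr.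
  by rewrite expr2; nra.
have : 1 <= Num.sqrt x by rewrite -{1}sqrtr1 ler_wsqrtr // ltW.
have := expRN_le1 x0; nra.
Qed.

(** In other words x <= 2 sinh (x / 2), after squaring and multiplication by
    exp (- x). This is what bounds e^(-x) / (1 - e^(-x))^2 by x^(-2). *)
Lemma expRN_div_sqr_le x : 0 <= x ->
  x ^+ 2 * expR (- x) <= (1 - expR (- x)) ^+ 2.
Proof.
move=> x0; pose h := x / 2.
have h0 : 0 <= h by rewrite /h; lra.
have A : 2 * h <= expR h - expR (- h).
  by have := expR_ge1DxD2 h0; have := onesubexpRN_ge h0; lra.
have eh := expR_gt0 (- h).
have E : expR (- x) = expR (- h) ^+ 2.
  by rewrite -expRM_natl; congr expR; rewrite /h; field.
have EE : expR h * expR (- h) = 1 by rewrite -expRD subrr expR0.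
have -> : x ^+ 2 * expR (- x) = (2 * h * expR (- h)) ^+ 2.
  by rewrite E exprMn; congr (_ ^+ 2 * _); rewrite /h; field.
have l0 : 0 <= 2 * h * expR (- h) by rewrite !mulr_ge0 ?expR_ge0.
rewrite ler_pXn2r ?nnegrE ?onesubexpRN_ge0 //.
have -> : 1 - expR (- x) = (expR h - expR (- h)) * expR (- h).
  by rewrite E mulrBl EE expr2.
by rewrite ler_pM2r.
Qed.

Lemma bernoulli_sub (y : R) n : 0 <= y <= 1 -> 1 - y ^+ n <= n%:R * (1 - y).
Proof.
move=> /andP[y0 y1]; elim: n => [|n IH]; first by rewrite expr0 mul0r subrr.
have : y ^+ n <= 1 by apply: exprn_ile1.
have : 0 <= y ^+ n by apply: exprn_ge0.
by rewrite exprS -natr1; nra.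
Qed.

End ExpBounds.

(** * Series dominated by the series of zeta(3/2) *)

Section Series.
Variable R : realType.
Implicit Types f g h : nat -> R.

Lemma cvg_series_lin a b f g : cvgn (series f) -> cvgn (series g) ->
  cvgn (series (fun j => a * f j + b * g j)) /\
  limn (series (fun j => a * f j + b * g j)) =
  a * limn (series f) + b * limn (series g).
Proof.
move=> cf cg.
have -> : (fun j => a * f j + b * g j) = (a *: f + b *: g)%R by apply/funext.
have cf' : cvgn (series (a *: f)) by apply: is_cvg_seriesZ.
have cg' : cvgn (series (b *: g)) by apply: is_cvg_seriesZ.
split; first exact: is_cvg_seriesD.
by rewrite lim_seriesD // !lim_seriesZ.
Qed.

Lemma lim_series_le_lin a b h f g :
  cvgn (series h) -> cvgn (series f) -> cvgn (series g) ->
  (forall j, h j <= a * f j + b * g j) ->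
  limn (series h) <= a * limn (series f) + b * limn (series g).
Proof.
move=> ch cf cg H; have [cl <-] := cvg_series_lin a b cf cg.
exact: lim_series_le.
Qed.

Lemma lim_series_ge_lin a b h f g :
  cvgn (series h) -> cvgn (series f) -> cvgn (series g) ->
  (forall j, a * f j + b * g j <= h j) ->
  a * limn (series f) + b * limn (series g) <= limn (series h).
Proof.
move=> ch cf cg H; have [cl <-] := cvg_series_lin a b cf cg.
exact: lim_series_le.
Qed.

(** The terms of zeta(3/2), zeta(2) and zeta(3). The first dominates every
    series below. *)
Definition inv32 (j : nat) : R := (j.+1%:R * Num.sqrt j.+1%:R)^-1.
Definition inv2 (j : nat) : R := j.+1%:R ^- 2.
Definition inv3 (j : nat) : R := j.+1%:R ^- 3.

Lemma inv32_ge0 j : 0 <= inv32 j.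
Proof. by rewrite invr_ge0 mulr_ge0 ?sqrtr_ge0. Qed.

Lemma sqrt_nat_gt0 j : 0 < Num.sqrt j.+1%:R :> R.
Proof. by rewrite sqrtr_gt0. Qed.

(** Comparison with the integral of x^(-3/2), in telescoped form. *)
Lemma series_inv32_le n : series inv32 n.+1 <= 3 - 2 / Num.sqrt n.+1%:R.
Proof.
elim: n => [|n IH].
  by rewrite seriesEnat /= big_nat1 /inv32 sqrtr1 mulr1 invr1; lra.
rewrite seriesSr; apply: le_trans (lerD IH (lexx _)) _; rewrite /inv32.
have a0 := sqrt_nat_gt0 n; have b0 := sqrt_nat_gt0 n.+1.
have aE : Num.sqrt n.+1%:R ^+ 2 = n.+1%:R :> R by rewrite sqr_sqrtr.
have bE : Num.sqrt n.+2%:R ^+ 2 = n.+2%:R :> R by rewrite sqr_sqrtr.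
have ab : Num.sqrt n.+2%:R ^+ 2 = Num.sqrt n.+1%:R ^+ 2 + 1 :> R.
  by rewrite aE bE -natr1.
move: bE a0 b0 ab {aE IH}; set a := Num.sqrt n.+1%:R; set b := Num.sqrt n.+2%:R.
move=> <-; clearbody a b => a0 b0 ab.
have -> : 3 - 2 / b = (3 - 2 / a) + (2 / a - 2 / b) by ring.
rewrite lerD2l.
have lab : a <= b by nra.
have -> : 2 / a - 2 / b = 2 * (b - a) / (a * b).
  by field; rewrite !lt0r_neq0.
have e : (b - a) * (a + b) = 1.
  have -> : (b - a) * (a + b) = b ^+ 2 - a ^+ 2 by ring.
  by rewrite ab addrC addKr.
have ab0 := lt0r_neq0 (addr_gt0 a0 b0).
have -> : b - a = (a + b)^-1 by apply: (mulIf ab0); rewrite e mulVf.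
have -> : 2 / (a + b) / (a * b) = ((a + b) * a * b / 2)^-1.
  by field; rewrite ab0 !lt0r_neq0.
have p1 : 0 < (a + b) * a * b / 2 by rewrite divr_gt0 ?mulr_gt0 ?addr_gt0.
have p2 : 0 < b ^+ 2 * b by rewrite !mulr_gt0.
rewrite lef_pV2 ?posrE //.
have : (a + b) * a <= 2 * b * b by nra.
by nra.
Qed.

Lemma cvg_inv32 : cvgn (series inv32).
Proof.
apply: nondecreasing_is_cvgn.
  by apply: nondecreasing_series => n _ _; exact: inv32_ge0.
exists 3 => _ [n _ <-].
apply: (@le_trans _ _ (series inv32 n.+1)).
  by rewrite seriesSr lerDl inv32_ge0.
apply: le_trans (series_inv32_le n) _.
by rewrite gerBl divr_ge0 // sqrtr_ge0.
Qed.

Lemma cvg_series_inv32 C f :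
  (forall j, 0 <= f j) -> (forall j, f j <= C * inv32 j) -> cvgn (series f).
Proof.
move=> f0 fC; have [cl _] := cvg_series_lin C 0 cvg_inv32 cvg_inv32.
apply: series_le_cvg cl => // j; rewrite mul0r addr0 //.
by apply: le_trans (f0 j) (fC j).
Qed.

Lemma inv2_le j : inv2 j <= inv32 j.
Proof.
rewrite lef_pV2 ?posrE ?mulr_gt0 ?exprn_gt0 // ?sqrt_nat_gt0 //.
rewrite expr2 ler_pM2l // -{2}(@sqr_sqrtr _ j.+1%:R) // expr2.
by rewrite ler_peMr ?sqrtr_ge0 // -{1}sqrtr1 ler_wsqrtr // ler1n.
Qed.

Lemma inv3_le j : inv3 j <= inv2 j.
Proof.
by rewrite lef_pV2 ?posrE ?exprn_gt0 // ler_weXn2l // ler1n.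
Qed.

Lemma inv2_ge0 j : 0 <= inv2 j. Proof. by rewrite invr_ge0 exprn_ge0. Qed.
Lemma inv3_ge0 j : 0 <= inv3 j. Proof. by rewrite invr_ge0 exprn_ge0. Qed.

Lemma cvg_inv2 : cvgn (series inv2).
Proof.
by apply: (@cvg_series_inv32 1) => j; [exact: inv2_ge0|rewrite mul1r inv2_le].
Qed.

Lemma cvg_inv3 : cvgn (series inv3).
Proof.
apply: (@cvg_series_inv32 1) => j; first exact: inv3_ge0.
by rewrite mul1r (le_trans (inv3_le j)) // inv2_le.
Qed.

Definition zeta32 : R := limn (series inv32).
Definition zeta2 : R := limn (series inv2).
Definition zeta3 : R := limn (series inv3).

Lemma ge1_lim_series f : (forall j, 0 <= f j) -> f 0%N = 1 -> cvgn (series f) ->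
  1 <= limn (series f).
Proof.
move=> f0 f1 cf; have <- : series f 1 = 1 by rewrite seriesEnat /= big_nat1.
apply: (nondecreasing_cvgn_le (nondecreasing_series _) cf) => n _ _.
exact: f0.
Qed.

Lemma zeta3_ge1 : 1 <= zeta3.
Proof.
by apply: ge1_lim_series cvg_inv3; [exact: inv3_ge0|rewrite /inv3 expr1n invr1].
Qed.

Lemma zeta32_ge1 : 1 <= zeta32.
Proof.
apply: ge1_lim_series cvg_inv32; first exact: inv32_ge0.
by rewrite /inv32 sqrtr1 mulr1 invr1.
Qed.

Lemma zeta2_ge1 : 1 <= zeta2.
Proof.
by apply: ge1_lim_series cvg_inv2; [exact: inv2_ge0|rewrite /inv2 expr1n invr1].
Qed.

Lemma zeta3E : zeta 3 = zeta3.
Proof.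
rewrite /zeta /zeta3; congr (limn (series _)); apply/funext => j.
by rewrite /riemannR /inv3 powR_mulrn.
Qed.

End Series.

Local Notation eta := Pilot.Defs.eta.

(** * The function eta *)

Section Eta.
Variable R : realType.
Implicit Types s t : R.
Local Notation c j := (j.+1%:R : R).

(** The termwise derivative of eta. *)
Definition eta1 t : R := limn (series (fun j => expR (- (c j * t)) / c j ^+ 2)).

Lemma c_gt0 j : 0 < c j. Proof. by []. Qed.
Lemma c_ge1 j : 1 <= c j. Proof. by rewrite ler1n. Qed.
Hint Resolve c_gt0 c_ge1 : core.

Lemma cvg_eta t : 0 <= t ->
  cvgn (series (fun j => (1 - expR (- (c j * t))) / c j ^+ 3)).
Proof.
move=> t0; apply: (@cvg_series_inv32 R 1) => j.
  by rewrite mulr_ge0 ?inv3_ge0 ?onesubexpRN_ge0 ?mulr_ge0.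
rewrite mul1r (le_trans _ (inv2_le R j)) // (le_trans _ (inv3_le R j)) //.
by apply: ler_piMl; rewrite ?inv3_ge0 // gerBl expR_ge0.
Qed.

Lemma cvg_eta1 t : 0 <= t ->
  cvgn (series (fun j => expR (- (c j * t)) / c j ^+ 2)).
Proof.
move=> t0; apply: (@cvg_series_inv32 R 1) => j.
  by rewrite mulr_ge0 ?inv2_ge0 ?expR_ge0.
rewrite mul1r (le_trans _ (inv2_le R j)) //.
by apply: ler_piMl; rewrite ?inv2_ge0 // expRN_le1 ?mulr_ge0.
Qed.

(** eta lies below its tangents, being a sum of concave functions. *)
Lemma eta_tangent s t : 0 <= s -> 0 <= t -> eta s <= eta t + (s - t) * eta1 t.
Proof.
move=> s0 t0; rewrite -[eta t]mul1r.
rewrite /Pilot.Defs.eta /eta1 ?/zeta32 ?/zeta2;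
  apply: (lim_series_le_lin (cvg_eta s0) (cvg_eta t0) (cvg_eta1 t0)) => j.
have -> : 1 * ((1 - expR (- (c j * t))) / c j ^+ 3)
   + (s - t) * (expR (- (c j * t)) / c j ^+ 2) =
   (1 - expR (- (c j * t))
     + (c j * s - c j * t) * expR (- (c j * t))) / c j ^+ 3.
  by field; rewrite lt0r_neq0.
rewrite ler_wpM2r ?invr_ge0 ?exprn_ge0 //.
move: (c j * t) (c j * s) => u v.
have -> : - v = - u + - (v - u) by ring.
rewrite expRD; have := onesubexpRN_le (v - u); have := expR_gt0 (- u); nra.
Qed.

Lemma eta0 : eta (0 : R) = 0.
Proof.
rewrite /Pilot.Defs.eta (_ : (fun j => _) = fun=> 0 : R); last first.
  by apply/funext => j; rewrite mulr0 oppr0 expR0 subrr mul0r.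
rewrite (_ : series _ = fun=> 0); first exact: lim_cst.
by apply/funext => n; rewrite seriesEnat /= big1.
Qed.

Lemma expRN_sub_le_sqrt u v : 0 <= u -> 0 <= v ->
  expR (- u) - expR (- v) <= Num.sqrt `|u - v| :> R.
Proof.
move=> u0 v0; have [uv|vu] := leP u v; last first.
  apply: le_trans (sqrtr_ge0 _); rewrite subr_le0 ler_expR lerN2; exact: ltW.
have w0 : 0 <= v - u by rewrite subr_ge0.
rewrite distrC ger0_norm //.
have -> : expR (- v) = expR (- u) * expR (- (v - u)).
  by rewrite -expRD; congr expR; ring.
have := onesubexpRN_le_sqrt w0; have := onesubexpRN_ge0 w0.
have := expRN_le1 u0; have := expR_gt0 (- u); nra.
Qed.

(** Hoelder continuity with exponent 1/2, valid down to 0, where the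
    derivative of eta1 has a logarithmic singularity. *)
Lemma eta1_sqrt s t : 0 <= s -> 0 <= t ->
  eta1 s <= eta1 t + Num.sqrt `|s - t| * zeta32 R.
Proof.
move=> s0 t0; rewrite -[eta1 t]mul1r.
rewrite /Pilot.Defs.eta /eta1 ?/zeta32 ?/zeta2;
  apply: (lim_series_le_lin (cvg_eta1 s0) (cvg_eta1 t0) (@cvg_inv32 R)) => j.
rewrite -lerBlDl mul1r -mulrBl.
have := @expRN_sub_le_sqrt (c j * s) (c j * t);
  rewrite !mulr_ge0 // => /(_ isT isT).
rewrite -mulrBr normrM ger0_norm // sqrtrM // => h.
rewrite ler_pdivrMr ?exprn_gt0 //; apply: le_trans h _.
have q0 := sqrt_nat_gt0 R j.
rewrite /inv32 -[X in _ <= _ * (X * _)^-1 * X ^+ 2](@sqr_sqrtr _ (c j)) //.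
by rewrite le_eqVlt; apply/orP; left; apply/eqP; field; rewrite lt0r_neq0.
Qed.

Lemma eta1_ge0 t : 0 <= t -> 0 <= eta1 t.
Proof.
move=> t0; have := @lim_series_ge_lin R 0 0 _ _ _ (cvg_eta1 t0) (cvg_eta1 t0)
  (cvg_eta1 t0); rewrite !mul0r addr0; apply => j.
by rewrite !mul0r addr0 mulr_ge0 ?expR_ge0 ?inv2_ge0.
Qed.

Lemma eta_le_zeta3 t : 0 <= t -> eta t <= zeta3 R.
Proof.
move=> t0; apply: lim_series_le; [exact: cvg_eta|exact: cvg_inv3|] => j.
by apply: ler_piMl; rewrite ?inv3_ge0 // gerBl expR_ge0.
Qed.

Lemma eta_ge_zeta3 t : 0 <= t -> (1 - expR (- t)) * zeta3 R <= eta t.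
Proof.
move=> t0; have := @lim_series_ge_lin R (1 - expR (- t)) 0 _ _ _ (cvg_eta t0)
  (@cvg_inv3 R) (@cvg_inv3 R); rewrite mul0r addr0; apply => j.
rewrite mul0r addr0 ler_wpM2r ?inv3_ge0 // lerD2l lerN2 ler_expR lerN2.
exact: ler_peMl.
Qed.

Lemma eta_le_lin t : 0 <= t -> eta t <= t * zeta2 R.
Proof.
move=> t0; have := @lim_series_le_lin R t 0 _ _ _ (cvg_eta t0)
  (@cvg_inv2 R) (@cvg_inv2 R); rewrite mul0r addr0; apply => j.
rewrite mul0r addr0 ler_pdivrMr ?exprn_gt0 //.
apply: le_trans (onesubexpRN_le _) _; rewrite /inv2.
by rewrite le_eqVlt; apply/orP; left; apply/eqP; field; rewrite lt0r_neq0.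
Qed.

(** The error term of the expansion at 0: the loss x - (1 - exp (- x)) is at
    most x^(3/2), which is summable after division by j^3. *)
Lemma eta_ge_lin t : 0 <= t -> t * zeta2 R - t * Num.sqrt t * zeta32 R <= eta t.
Proof.
move=> t0; rewrite -mulNr.
rewrite /Pilot.Defs.eta /eta1 ?/zeta32 ?/zeta2;
  apply: (lim_series_ge_lin (cvg_eta t0) (@cvg_inv2 R) (@cvg_inv32 R)) => j.
rewrite ler_pdivlMr ?exprn_gt0 //.
have ct0 : 0 <= c j * t by rewrite mulr_ge0.
have := expRN_sub_lin_le ct0; rewrite sqrtrM //.
have q0 := sqrt_nat_gt0 R j;
  have qE : Num.sqrt (c j) ^+ 2 = c j by rewrite sqr_sqrtr.
rewrite /inv32 /inv2; move: q0 qE; move: (Num.sqrt (c j)) => q q0 qE h.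
have -> : (t * c j ^- 2 + - (t * Num.sqrt t) * (c j * q)^-1) * c j ^+ 3 =
          c j * t - c j * t * (q * Num.sqrt t).
  by rewrite -qE; field; rewrite lt0r_neq0.
by lra.
Qed.

(** As a function of 1/x, eta (a x) / x^2 is convex: the inequality compares
    it with its tangent. It holds term by term, because 1 - exp (- w) >= w -
    w^2 / 2 for w = (l - 1) u and exp u >= 1 + u + u^2 / 2. *)
Lemma eta_scale t l : 0 <= t -> 1 <= l ->
  l * (2 - l) * eta t + l * (l - 1) * t * eta1 t <= eta (l * t).
Proof.
move=> t0 l1; have lt0 : 0 <= l * t by nra.
rewrite /Pilot.Defs.eta /eta1 ?/zeta32 ?/zeta2;
  apply: (lim_series_ge_lin (cvg_eta lt0) (cvg_eta t0) (cvg_eta1 t0)) => j.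
have -> : l * (2 - l) * ((1 - expR (- (c j * t))) / c j ^+ 3)
   + l * (l - 1) * t * (expR (- (c j * t)) / c j ^+ 2) =
   (l * (2 - l) * (1 - expR (- (c j * t)))
    + l * (l - 1) * (c j * t) * expR (- (c j * t))) / c j ^+ 3.
  by field; rewrite lt0r_neq0.
rewrite ler_wpM2r ?invr_ge0 ?exprn_ge0 // (mulrCA (c j) l t).
have u0 : 0 <= c j * t by rewrite mulr_ge0.
move: (c j * t) u0 => u u0.
have w0 : 0 <= (l - 1) * u by rewrite mulr_ge0 // subr_ge0.
have -> : - (l * u) = - u + - ((l - 1) * u) by ring.
rewrite expRD.
have A := onesubexpRN_ge w0; have B := expR_ge1DxD2 u0.
have e0 := expR_gt0 (- u).
have E : expR u * expR (- u) = 1 by rewrite -expRD subrr expR0.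
move: A B e0 E; move: (expR (- u)) (expR u) (expR _) => e f g A B e0 E.
have A' : 0 <= e * (1 - g - ((l - 1) * u - ((l - 1) * u) ^+ 2 / 2)).
  by rewrite (mulr_ge0 (ltW e0)) // subr_ge0.
have B' : 0 <= e * (l - 1) ^+ 2 * (f - (1 + u + u ^+ 2 / 2)).
  by rewrite (mulr_ge0 (mulr_ge0 (ltW e0) (sqr_ge0 _))) // subr_ge0.
rewrite -subr_ge0.
(* f, e and g stand for exp u, exp (- u) and exp (- (l - 1) u) *)
have -> : 1 - e * g - (l * (2 - l) * (1 - e) + l * (l - 1) * u * e) =
  e * (1 - g - ((l - 1) * u - ((l - 1) * u) ^+ 2 / 2)) +
  e * (l - 1) ^+ 2 * (f - (1 + u + u ^+ 2 / 2)) + (l - 1) ^+ 2 * (1 - f * e).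
  by field.
by rewrite E subrr mulr0 addr0 addr_ge0.
Qed.

(** The saddle point equation reads x^3 = psi (a x). *)
Definition psi t : R := 2 * eta t - t * eta1 t.

(** psi (t) / t^2 is nonincreasing, term by term. With u <= v, the difference
    of the two sides is the sum of a nonnegative polynomial in u and v - u,
    times exp (- u), and of nonnegative multiples of the Taylor remainders of
    exp u and exp (u - v). *)
Lemma psi_sqr s t : 0 <= s -> s <= t -> s ^+ 2 * psi t <= t ^+ 2 * psi s.
Proof.
move=> s0 st; have t0 := le_trans s0 st.
pose p u : R := 2 * (1 - expR (- u)) - u * expR (- u).
have psE r : 0 <= r -> cvgn (series (fun j => p (c j * r) / c j ^+ 3)) /\
    psi r = limn (series (fun j => p (c j * r) / c j ^+ 3)).
  move=> r0; have [cs es] := cvg_series_lin 2 (- r) (cvg_eta r0) (cvg_eta1 r0).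
  have E : (fun j => p (c j * r) / c j ^+ 3) =
      (fun j => 2 * ((1 - expR (- (c j * r))) / c j ^+ 3)
                + - r * (expR (- (c j * r)) / c j ^+ 2)).
    by apply/funext => j; rewrite /p; field; rewrite lt0r_neq0.
  by rewrite E; split=> //; rewrite es /psi mulNr.
have [cs ->] := psE s s0; have [ct ->] := psE t t0.
have := @lim_series_le_lin R (t ^+ 2) 0 _ _ _
  (@cvg_series_lin R (s ^+ 2) 0 _ _ ct ct).1 cs cs.
rewrite (@cvg_series_lin R (s ^+ 2) 0 _ _ ct ct).2 !mul0r !addr0; apply => j.
rewrite !mul0r !addr0 !mulrA ler_wpM2r ?invr_ge0 ?exprn_ge0 //.
rewrite -(@ler_pM2l _ (c j ^+ 2)) ?exprn_gt0 //.
rewrite [leLHS]mulrA [leRHS]mulrA -!exprMn.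
have : c j * s <= c j * t by rewrite ler_pM2l.
have : 0 <= c j * s by rewrite mulr_ge0.
move: (c j * s) (c j * t) => u v u0 uv {cs ct}.
have e0 := expR_gt0 (- u).
have E : expR u * expR (- u) = 1 by rewrite -expRD subrr expR0.
have w0 : 0 <= v - u by rewrite subr_ge0.
have A := expR_ge1Dx (- (v - u)).
have ev : expR (- v) = expR (- u) * expR (- (v - u)).
  by rewrite -expRD; congr expR; ring.
have U := expR_ge1DxD2 u0.
rewrite /p ev -subr_ge0.
move: U A e0 E; move: (expR u) (expR (- u)) (expR (- (v - u))) =>
  f e g U A e0 E.
have v0 := le_trans u0 uv.
have g0 : 0 <= g - (1 - (v - u)) by lra.
have f0 : 0 <= f - (1 + u + u ^+ 2 / 2) by lra.
have H1 : 0 <= u ^+ 2 * (2 + v) * e * (g - (1 - (v - u))).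
  by rewrite !mulr_ge0 ?sqr_ge0 ?(ltW e0) // addr_ge0.
have H2 : 0 <= 2 * (v - u) * u * e * (f - (1 + u + u ^+ 2 / 2)).
  by rewrite !mulr_ge0 ?(ltW e0).
have H3 : 0 <= 2 * (v - u) ^+ 2 * e * (f - (1 + u + u ^+ 2 / 2)).
  by rewrite !mulr_ge0 ?sqr_ge0 ?(ltW e0).
have H4 : 0 <= e * (u ^+ 2 * (v - u) + u ^+ 3 * (v - u) + u * (v - u) ^+ 2).
  rewrite (mulr_ge0 (ltW e0)) // !addr_ge0 //.
  - by rewrite mulr_ge0 ?sqr_ge0.
  - by rewrite mulr_ge0 ?exprn_ge0.
  - by rewrite mulr_ge0 ?sqr_ge0.
(* f, e and g stand for exp u, exp (- u) and exp (u - v) *)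
have -> : v ^+ 2 * (2 * (1 - e) - u * e) - u ^+ 2 * (2 * (1 - e * g) - v * (e
  * g)) =
  u ^+ 2 * (2 + v) * e * (g - (1 - (v - u)))
  + 2 * (2 * (v - u) * u * e * (f - (1 + u + u ^+ 2 / 2)))
  + 2 * (v - u) ^+ 2 * e * (f - (1 + u + u ^+ 2 / 2))
  + e * (u ^+ 2 * (v - u) + u ^+ 3 * (v - u) + u * (v - u) ^+ 2)
  + 2 * (v ^+ 2 - u ^+ 2) * (1 - f * e) by field.
by rewrite E subrr mulr0 addr0; nra.
Qed.

End Eta.

(** * Existence and uniqueness of the saddle point *)

Section Saddle.
Variable R : realType.
Implicit Types s t x y : R.

(** The modulus is only required on nonnegative arguments, since the series
    diverge on the negative ones. *)
Lemma sqrt_modulus_continuous (f : R -> R) (C x : R) : 0 < x -> 0 < C ->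
  (forall y, 0 <= y -> `|f y - f x| <= C * Num.sqrt `|y - x|) ->
  {for x, continuous f}.
Proof.
move=> x0 C0 H; apply/cvgrPdist_lt => e e0.
have eC : 0 < e / C by rewrite divr_gt0.
apply/nbhs_ballP; exists (Num.min x ((e / C) ^+ 2)) => /=.
  by rewrite lt_min x0 exprn_gt0.
move=> y; rewrite /ball /= lt_min => /andP[yx yC].
rewrite distrC; apply: le_lt_trans (H y _) _.
  by move: yx; rewrite ltr_norml; lra.
rewrite mulrC -ltr_pdivlMr //.
have -> : e / C = Num.sqrt ((e / C) ^+ 2) by rewrite sqrtr_sqr gtr0_norm.
by rewrite ltr_sqrt ?exprn_gt0 // distrC.
Qed.

Lemma eta1_continuous t : 0 < t -> {for t, continuous (@eta1 R)}.
Proof.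
move=> t0; apply: (@sqrt_modulus_continuous _ (zeta32 R)) => //.
  exact: lt_le_trans (zeta32_ge1 R).
move=> s s0; have := eta1_sqrt s0 (ltW t0); have := eta1_sqrt (ltW t0) s0.
by rewrite (distrC t s) ler_norml; lra.
Qed.

(** By [eta_tangent] in both directions the difference quotient lies between
    eta1 s and eta1 t, so the Hoelder bound of eta1 is also one for the
    difference quotient. *)
Lemma is_derive_eta t : 0 < t -> is_derive t 1 (eta : R -> R) (eta1 t).
Proof.
move=> t0; apply/is_derive1_caratheodory.
exists (fun s => if s == t then eta1 t else (eta s - eta t) / (s - t)); split.
- move=> s; case: eqVneq => [->|st]; first by rewrite !subrr mulr0.
  by rewrite divfK // subr_eq0.
- apply: (@sqrt_modulus_continuous _ (zeta32 R)) => //.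
    exact: lt_le_trans (zeta32_ge1 R).
  move=> s s0; rewrite eqxx; case: eqVneq => [->|st].
    by rewrite !subrr normr0 sqrtr0 mulr0.
  have st0 : 0 < `|s - t| by rewrite normr_gt0 subr_eq0.
  rewrite -(ler_pM2r st0) -normrM mulrBl divfK ?subr_eq0 //.
  have t1 := eta_tangent s0 (ltW t0); have t2 := eta_tangent (ltW t0) s0.
  have m1 := eta1_sqrt s0 (ltW t0); have m2 := eta1_sqrt (ltW t0) s0.
  rewrite (distrC t s) in m2.
  move: m1 m2; move: (Num.sqrt _ * _) (mulrC (zeta32 R) (Num.sqrt `|s - t|))
    => M.
  move=> ->; rewrite ler_norml => m1 m2.
  case: (ltgtP s t) st st0 => // [slt|tls] _ _.
    by rewrite ltr0_norm ?subr_lt0 // ; nra.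
  by rewrite gtr0_norm ?subr_gt0 //; nra.
- by rewrite eqxx.
Qed.

Lemma derive1_eta t : 0 < t -> derive1 (eta : R -> R) t = eta1 t.
Proof. by move=> t0; rewrite derive1E; have := is_derive_eta t0 => -[]. Qed.

Lemma saddle_pointE (a x : R) : 0 < a ->
  saddle_point a x <-> 0 < x /\ x ^+ 3 = psi (a * x).
Proof.
move=> a0; rewrite /saddle_point /psi; split=> -[x0]; have ax := mulr_gt0 a0 x0;
  rewrite derive1_eta //; last by move=> ->; split=> //; ring.
by move=> /eqP h; split=> //; apply/eqP; rewrite -subr_eq0 -(eqP h);
  apply/eqP; ring.
Qed.

Lemma eta1_le_eta t : 0 <= t -> t * eta1 t <= eta t.
Proof.
move=> t0; have := eta_tangent (lexx 0) t0; rewrite eta0 sub0r mulNr; lra.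
Qed.

Lemma eta_le_psi t : 0 <= t -> eta t <= psi t.
Proof. by move=> t0; have := eta1_le_eta t0; rewrite /psi; lra. Qed.

Lemma eta_ge_onesub t : 0 <= t -> 1 - expR (- t) <= eta t.
Proof.
move=> t0; apply: le_trans (eta_ge_zeta3 t0).
by rewrite ler_peMr ?zeta3_ge1 // onesubexpRN_ge0.
Qed.

Lemma onesubexpRN_ge_div t : 0 <= t -> t / (1 + t) <= 1 - expR (- t).
Proof.
move=> t0; have h := expR_ge1Dx t; have p : 0 < 1 + t by lra.
have E : expR t * expR (- t) = 1 by rewrite -expRD subrr expR0.
have := expR_gt0 (- t) => e0.
rewrite ler_pdivrMr //; nra.
Qed.

Lemma psi_le t : 0 <= t -> psi t <= 2 * zeta3 R.
Proof.
move=> t0; have := eta_le_zeta3 t0; have := mulr_ge0 t0 (eta1_ge0 t0).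
by rewrite /psi; lra.
Qed.

(** If x^3 = psi (a x) and y^3 = psi (a y) with x <= y, then y <= x follows
    from the monotonicity of psi (t) / t^2. *)
Lemma saddle_point_uniq (a x y : R) : 0 < a ->
  saddle_point a x -> saddle_point a y -> x = y.
Proof.
move=> a0 /(saddle_pointE _ a0)[x0 hx] /(saddle_pointE _ a0)[y0 hy].
wlog: x y x0 y0 hx hy / x <= y.
  by move=> H; have [xy|/ltW yx] := leP x y; [|symmetry]; exact: H.
move=> xy; apply/eqP; rewrite eq_le xy /=.
have := @psi_sqr R (a * x) (a * y);
  rewrite (mulr_ge0 (ltW a0) (ltW x0)) ler_pM2l //.
move=> /(_ isT xy); rewrite -hx -hy !exprMn.
have -> : a ^+ 2 * x ^+ 2 * y ^+ 3 = (a * x * y) ^+ 2 * y by ring.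
have -> : a ^+ 2 * y ^+ 2 * x ^+ 3 = (a * x * y) ^+ 2 * x by ring.
by rewrite ler_pM2l // exprn_gt0 // !mulr_gt0.
Qed.

Lemma psi_continuous t : 0 < t -> {for t, continuous (@psi R)}.
Proof.
move=> t0.
have c0 : {for t, continuous (eta : R -> R)}.
  apply: differentiable_continuous; apply/derivable1_diffP.
  by have [] := is_derive_eta t0.
apply: continuousB; first by apply: continuousM => //; exact: cst_continuous.
by apply: continuousM; [exact: cvg_id | exact: eta1_continuous].
Qed.

(** Intermediate value theorem for x^3 - psi (a x): negative at a / (1 + a)
    because psi (t) >= eta t >= t / (1 + t), and nonnegative at 2 zeta(3)
    because psi <= 2 zeta(3). *)
Lemma saddle_point_ex (a : R) : 0 < a -> exists x : R, saddle_point a x.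
Proof.
move=> a0; pose k x := x ^+ 3 - psi (a * x).
pose x0 := a / (1 + a); pose x1 := 2 * zeta3 R.
have Z3g := zeta3_ge1 R.
have p0 : 0 < x0 by rewrite divr_gt0 //; lra.
have x01 : x0 <= 1 by rewrite ler_pdivrMr; lra.
have x11 : 1 <= x1 by rewrite /x1; lra.
have kc : {within `[x0, x1], continuous k}.
  apply: continuous_in_subspaceT => x; rewrite inE /= in_itv /= => /andP[h _].
  have xp : 0 < x by apply: lt_le_trans h.
  rewrite /k; apply: (@continuousB _ _ _ (fun x => x ^+ 3) (fun x =>
    psi (a * x))); first exact: exprn_continuous.
  apply: (@continuous_comp _ _ _ (fun y => a * y) (@psi R)).
    by apply: continuousM; [exact: cst_continuous|exact: cvg_id].
  by apply: psi_continuous; rewrite mulr_gt0.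
have k0 : k x0 <= 0.
  rewrite /k subr_le0; have ax0 : 0 <= a * x0 by rewrite mulr_ge0 ?ltW.
  apply: le_trans (eta_le_psi ax0); apply: le_trans (eta_ge_onesub ax0).
  apply: le_trans (onesubexpRN_ge_div ax0).
  rewrite ler_pdivlMr; last by lra.
  have : x0 * (1 + a) = a by rewrite /x0 divfK // lt0r_neq0 //; lra.
  have s1 : x0 ^+ 2 <= x0 by rewrite expr2 ler_piMl // ltW.
  have : x0 ^+ 2 * (1 + a * x0) <= a.
    apply: (@le_trans _ _ (x0 * (1 + a)));
      last by rewrite /x0 divfK // lt0r_neq0 //; lra.
    apply: ler_pM; rewrite ?sqr_ge0 //; first lra.
    by rewrite lerD2l ler_piMr // ltW.
  by rewrite exprS => h _; rewrite -mulrA mulrC ler_pM2r.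
have k1 : 0 <= k x1.
  rewrite /k subr_ge0; have ax1 : 0 <= a * x1 by rewrite mulr_ge0 ?ltW //; lra.
  apply: le_trans (psi_le ax1) _; rewrite -/x1.
  by rewrite -{1}[x1]expr1 ler_weXn2l.
have [|x xI /eqP] := @IVT R k x0 x1 0 (le_trans x01 x11) kc.
  by rewrite ge_min le_max k0 k1 orbT.
rewrite subr_eq0 => /eqP kx; move: xI; rewrite in_itv /= => /andP[h _].
exists x; apply/saddle_pointE => //; split=> //; exact: lt_le_trans h.
Qed.

End Saddle.

(** * The value of zeta(2) *)

Section Basel.
Variable R : realType.
Implicit Type x : R.
Local Notation pi := (@pi R).

Lemma sin_le x : 0 <= x -> sin x <= x :> R.
Proof.
move=> x0; have : (id 0 - sin 0 : R) <= id x - sin x.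
  apply: (@ge0_is_derive_le R (fun y => id y - sin y) (fun y =>
    1 - cos y)) => // y _.
by rewrite sin0; lra.
Qed.

Lemma mul_cos_le_sin x : 0 <= x <= pi -> x * cos x <= sin x :> R.
Proof.
move=> /andP[x0 xpi]; have : sin 0 - 0 * cos 0 <= sin x - x * cos x :> R.
  apply: (@ge0_is_derive_le R (fun y => sin y - y * cos y) (fun y =>
    y * sin y)) => // y /andP[y0 yx].
    apply: is_derive_eq; rewrite /GRing.scale /=; ring.
  by rewrite mulr_ge0 // sin_ge0_pi // y0 (le_trans yx).
by rewrite sin0; lra.
Qed.

Definition odd_angle (n k : nat) : R := k.*2.+1%:R * pi / (2 ^+ n.+2).
Definition csc2_sum (n : nat) : R :=
  \sum_(k < 2 ^ n) (sin (odd_angle n k)) ^- 2.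

Lemma odd_angle_itv n k : (k < 2 ^ n)%N -> 0 < odd_angle n k < pi / 2.
Proof.
move=> kn; rewrite /odd_angle; have e2 : 0 < 2 ^+ n.+2 :> R by apply: exprn_gt0.
apply/andP; split; first by rewrite divr_gt0 // mulr_gt0 // pi_gt0.
rewrite ltr_pdivrMr //.
have -> : pi / 2 * 2 ^+ n.+2 = 2 ^+ n.+1 * pi by rewrite exprS; field.
by rewrite ltr_pM2r ?pi_gt0 // -natrX ltr_nat expnS; lia.
Qed.

(** The double angle formula for the sine; the two angles on the left are x /
    2 and its reflection in pi / 4. *)
Lemma csc2_half x : 0 < x <= pi / 2 ->
  (sin (x / 2)) ^- 2 + (sin (pi / 2 - x / 2)) ^- 2 = 4 * (sin x) ^- 2 :> R.
Proof.
move=> /andP[x0 xpi].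
have -> : sin (pi / 2 - x / 2) = cos (x / 2).
  by rewrite addrC sinDpihalf cosN.
have p0 := pi_gt0 R.
have s0 : 0 < sin (x / 2) by rewrite sin_gt0_pihalf //; apply/andP; split; lra.
have c0 : 0 < cos (x / 2) by rewrite cos_gt0_pihalf //; apply/andP; split; lra.
have -> : sin x = 2 * (cos (x / 2) * sin (x / 2)).
  by rewrite mulr_natl -sin_mulr2n; congr sin; rewrite -mulr_natl; field.
have := cos2Dsin2 (x / 2); move: s0 c0; move: (sin _) (cos _) => s c s0 c0 E.
have -> : s ^- 2 + c ^- 2 = (c ^+ 2 + s ^+ 2) / (c * s) ^+ 2.
  by field; rewrite !lt0r_neq0.
by rewrite E; field; rewrite !lt0r_neq0.
Qed.

(** The angles (2k+1) pi / 2^(n+3) are the halves of the angles of the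
    previous stage together with the complements of these halves, so
    [csc2_half] applies to them in pairs. *)
Lemma csc2_sumS n : csc2_sum n.+1 = 4 * csc2_sum n.
Proof.
rewrite /csc2_sum; have E : (2 ^ n.+1 = 2 ^ n + 2 ^ n)%N by rewrite expnS; lia.
rewrite -(big_mkord predT (fun k => sin (odd_angle n.+1 k) ^- 2)) E.
rewrite (@big_cat_nat _ _ _ (2 ^ n)%N) //= ?leq_addl //.
rewrite -{2}(add0n (2 ^ n)%N) big_addn addnK [X in _ + X]big_nat_rev add0n /=.
rewrite -big_split /= big_mkord big_distrr /=; apply: eq_bigr => k _.
have /andP[a0 /ltW a1] := odd_angle_itv (ltn_ord k).
rewrite -csc2_half ?a0 //; congr (sin _ ^- 2 + sin _ ^- 2).
  by rewrite /odd_angle [in LHS]exprS; field; rewrite expf_neq0.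
have kn := ltn_ord k.
have -> : odd_angle n.+1 (2 ^ n - k.+1 + 2 ^ n) =
          (2 ^+ n.+2 - k.*2.+1%:R) * pi / 2 ^+ n.+3.
  rewrite /odd_angle -(natrX R 2 n.+2) -natrB; last by rewrite !expnS; lia.
  by congr (_%:R * _ / _); rewrite !expnS; lia.
by rewrite /odd_angle [2 ^+ n.+3]exprS; field; rewrite expf_neq0.
Qed.

Lemma csc2_sumE n : csc2_sum n = 2 * 4 ^+ n.
Proof.
elim: n => [|n IH]; last by rewrite csc2_sumS IH exprS; ring.
rewrite /csc2_sum big_ord1 /odd_angle expr0 mulr1 mul1r.
have -> : pi / 2 ^+ 2 = pi / 2 / 2 by field.
have p0 := pi_gt0 R.
have h2 : 0 < pi / 2 <= pi / 2 by rewrite lexx andbT divr_gt0.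
have := csc2_half h2; rewrite sin_pihalf expr1n invr1.
have -> : pi / 2 - pi / 2 / 2 = pi / 2 / 2 by field.
by rewrite ?expr0; lra.
Qed.

(** From sin x <= x <= tan x. *)
Lemma csc2_bounds x : 0 < x < pi / 2 ->
  x ^- 2 <= (sin x) ^- 2 <= 1 + x ^- 2.
Proof.
move=> xpi; have s0 := sin_gt0_pihalf xpi; move: xpi => /andP[x0 xpi].
have p0 := pi_gt0 R; have sx := sin_le (ltW x0).
have cs : x * cos x <= sin x by apply: mul_cos_le_sin; apply/andP; split; lra.
have c0 : 0 <= cos x by apply/ltW/cos_gt0_pihalf; apply/andP; split; lra.
have E := cos2Dsin2 x.
apply/andP; split.
  by rewrite lef_pV2 ?posrE ?exprn_gt0 // ler_pXn2r ?nnegrE ?(ltW x0) ?(ltW s0).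
have -> : (sin x) ^- 2 = 1 + (cos x / sin x) ^+ 2.
  have -> : 1 + (cos x / sin x) ^+ 2 = (cos x ^+ 2 + sin x ^+ 2) / sin x ^+ 2.
    by field; rewrite lt0r_neq0.
  by rewrite E mul1r.
rewrite lerD2l -exprVn ler_pXn2r ?nnegrE ?invr_ge0 ?(ltW x0) ?divr_ge0 ?(ltW
  s0) //.
by rewrite ler_pdivrMr // mulrC ler_pdivlMr // mulrC.
Qed.

Definition odd_sum (n : nat) : R := \sum_(k < 2 ^ n) (k.*2.+1%:R) ^- 2.

(** The squared cosecants sum to 2 * 4^n exactly, and each of the 2^n terms
    differs from the inverse square of its angle by at most 1. *)
Lemma odd_sum_bounds n :
  pi ^+ 2 / 8 - pi ^+ 2 / 16 * (2^-1) ^+ n <= odd_sum n <= pi ^+ 2 / 8.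
Proof.
have p0 : pi != 0 by rewrite lt0r_neq0 // pi_gt0.
have f2 : 2 ^+ n != 0 :> R by rewrite expf_neq0 // pnatr_eq0.
have E4 : 4 ^+ n = 2 ^+ n * 2 ^+ n :> R by rewrite -exprMn -natrM.
have E : \sum_(k < 2 ^ n) (odd_angle n k) ^- 2
  = 16 * 4 ^+ n / pi ^+ 2 * odd_sum n.
  rewrite /odd_sum big_distrr; apply: eq_bigr => k _ /=; rewrite /odd_angle.
  rewrite E4 !exprS; have : k.*2.+1%:R != 0 :> R by rewrite pnatr_eq0.
  move: (2 ^+ n) f2 (k.*2.+1%:R) pi p0 => b b0 c p p0 c0.
  by field; rewrite p0 c0 b0.
have U : \sum_(k < 2 ^ n) (odd_angle n k) ^- 2 <= csc2_sum n.
  by apply: ler_sum => k _;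
    have /andP[] := csc2_bounds (odd_angle_itv (ltn_ord k)).
have L : csc2_sum n <= 2 ^+ n + \sum_(k < 2 ^ n) (odd_angle n k) ^- 2.
  have -> : 2 ^+ n = \sum_(k < 2 ^ n) (1 : R).
    by rewrite sumr_const card_ord natrX.
  rewrite -big_split; apply: ler_sum => k _.
  by have /andP[] := csc2_bounds (odd_angle_itv (ltn_ord k)).
move: U L; rewrite E csc2_sumE.
have pp : 0 < pi ^+ 2 / (16 * 4 ^+ n).
  by rewrite divr_gt0 ?mulr_gt0 ?exprn_gt0 // pi_gt0.
move=> U L; rewrite -(ler_pM2l pp) in U; rewrite -(ler_pM2l pp) in L.
move: U L; rewrite exprVn.
rewrite {pp} E4; move: (2 ^+ n) f2 (odd_sum n) pi p0 => b b0 s p p0.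
have -> : p ^+ 2 / (16 * (b * b)) * (16 * (b * b) / p ^+ 2 * s) = s.
  by field; rewrite p0 b0.
have -> : p ^+ 2 / (16 * (b * b)) * (2 * (b * b)) = p ^+ 2 / 8 by field.
have -> : p ^+ 2 / (16 * (b * b)) * (b + 16 * (b * b) / p ^+ 2 * s)
   = p ^+ 2 / 16 * b^-1 + s by field; rewrite p0 b0.
by move=> -> L; rewrite andbT; lra.
Qed.

Lemma odd_sumE n :
  odd_sum n = series (inv2 R) (2 ^ n.+1)%N - series (inv2 R) (2 ^ n)%N / 4.
Proof.
have E (N : nat) : series (inv2 R) N.*2 =
    \sum_(k < N) (k.*2.+1%:R) ^- 2 + series (inv2 R) N / 4.
  elim: N => [|N IH]; first by rewrite !seriesEnat /= !big_geq // big_ord0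
    mul0r addr0.
  rewrite doubleS !seriesSr IH big_ord_recr /= /inv2.
  have -> : N.*2.+2%:R = 2 * N.+1%:R :> R by rewrite -natrM; congr _%:R; lia.
  have : N.+1%:R != 0 :> R by rewrite pnatr_eq0.
  have : N.*2.+1%:R != 0 :> R by rewrite pnatr_eq0.
  move: (N.*2.+1%:R) (N.+1%:R) => c d c0 d0; field.
  by rewrite c0 d0.
by rewrite expnS mul2n E addrK.
Qed.

(** The odd terms of zeta(2) make up three quarters of it. *)
Lemma basel : zeta2 R = pi ^+ 2 / 6.
Proof.
have c2 : (fun n => 2 ^ n)%N @ \oo --> \oo.
  apply/cvgnyPge => A; exists A => // n /= An.
  by apply: leq_trans An (ltnW (ltn_expl _ _)).
have cS : (fun n => series (inv2 R) (2 ^ n)%N) @ \oo --> zeta2 R.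
  exact: (cvg_comp _ _ c2 (@cvg_inv2 R)).
have cS1 : (fun n => series (inv2 R) (2 ^ n.+1)%N) @ \oo --> zeta2 R.
  by move: cS; rewrite -cvg_shiftS.
(* odd_sum n converges both to 3/4 of zeta(2) and to pi^2 / 8 *)
have cO : odd_sum n @[n --> \oo] --> zeta2 R - zeta2 R / 4.
  rewrite (_ : odd_sum = fun n =>
    series (inv2 R) (2 ^ n.+1)%N - series (inv2 R) (2 ^ n)%N / 4).
    by apply: cvgB => //; apply: cvgMl.
  by apply/funext => n; rewrite odd_sumE.
have cO' : odd_sum n @[n --> \oo] --> pi ^+ 2 / 8.
  apply: (@squeeze_cvgr _ _ _ _ (fun n =>
    pi ^+ 2 / 8 - pi ^+ 2 / 16 * (2^-1) ^+ n)
    (fun=> pi ^+ 2 / 8)).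
  - by near=> n; exact: odd_sum_bounds.
  - rewrite -[X in _ --> X]subr0; apply: cvgB; first exact: cvg_cst.
    rewrite -[X in _ --> X](mulr0 (pi ^+ 2 / 16)); apply: cvgMr.
    apply: cvg_expr; rewrite ger0_norm; lra.
  - exact: cvg_cst.
have E : zeta2 R - zeta2 R / 4 = pi ^+ 2 / 8 by apply: cvg_unique cO cO'.
by lra.
Unshelve. all: by end_near. Qed.

End Basel.

(** * The growth function for small and large parameter *)

Section Growth.
Variable R : realType.
Implicit Types s t x y : R.

(** Since 0 <= t eta1 t <= eta t, the cube of the saddle point lies between
    eta and 2 eta, and eta is at most zeta(3). *)
Lemma saddle_bounds (a x : R) : 0 < a -> saddle_point a x ->
  [/\ 0 < x, x ^+ 3 = 2 * eta (a * x) - a * x * eta1 (a * x),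
      eta (a * x) <= x ^+ 3 & x ^+ 3 <= 2 * zeta3 R].
Proof.
move=> a0 /(saddle_pointE _ a0)[x0 hx]; have t0 := ltW (mulr_gt0 a0 x0).
by split=> //; rewrite hx; [exact: eta_le_psi|exact: psi_le].
Qed.

Lemma saddle_le (a x : R) : 0 < a -> saddle_point a x -> x <= 2 * zeta3 R.
Proof.
move=> a0 /(saddle_bounds a0)[x0 _ _ h]; have Z := zeta3_ge1 R.
have [x1|x1] := leP x 1; first by lra.
by apply: le_trans h; rewrite exprS ler_peMr ?(ltW x0) // exprn_ege1 // ltW.
Qed.

Lemma eta1_0 : eta1 (0 : R) = zeta2 R.
Proof.
rewrite /eta1 /zeta2; congr (limn (series _)); apply/funext => j.
by rewrite mulr0 oppr0 expR0 mul1r.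
Qed.

(** For t = a x small, eta t is zeta(2) t up to a factor 1 - d. The lower
    bound is the inequality of arithmetic and geometric means for x + c / x;
    the upper one uses that the growth is at most 2 x and bounds x by the
    saddle point equation. *)
Lemma growth_small (a x w d : R) : 0 < a -> saddle_point a x ->
  w = Num.sqrt (a * zeta2 R) -> d = zeta32 R * Num.sqrt (a * x) ->
  2 * w * (1 - d) <= x + x ^- 2 * eta (a * x) <= 2 * w * (1 + d).
Proof.
move=> a0 sx wD dD; have [x0 hx hle _] := saddle_bounds a0 sx.
have t0 := ltW (mulr_gt0 a0 x0); have Z2g := zeta2_ge1 R;
  have Z32g := zeta32_ge1 R.
have aZ : 0 < a * zeta2 R by rewrite mulr_gt0 //; lra.
have w0 : 0 < w by rewrite wD sqrtr_gt0.
have wE : w ^+ 2 = a * zeta2 R by rewrite wD sqr_sqrtr // ltW.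
have d0 : 0 <= d by rewrite dD mulr_ge0 ?sqrtr_ge0 //; lra.
have e1 : zeta2 R <= eta1 (a * x) + d.
  have := eta1_sqrt (lexx 0) t0; rewrite eta1_0 sub0r normrN ger0_norm //.
  by rewrite dD [zeta32 R * _]mulrC.
have e2 := eta_le_lin t0; have e3 := eta_ge_lin t0.
have dZ : d <= d * zeta2 R by rewrite ler_peMr.
apply/andP; split.
  have [d1|d1] := leP 1 d.
    apply: (@le_trans _ _ 0).
      by rewrite mulr_ge0_le0 ?mulr_ge0 ?(ltW w0) // subr_le0.
    rewrite addr_ge0 ?(ltW x0) // mulr_ge0 ?invr_ge0 ?exprn_ge0 ?(ltW x0) //.
    by apply: le_trans (eta_ge_onesub t0); exact: onesubexpRN_ge0.
  have l1 : x + a * (zeta2 R * (1 - d)) / x <= x + x ^- 2 * eta (a * x).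
    rewrite lerD2l ler_pdivrMr //.
    have -> : x ^- 2 * eta (a * x) * x = eta (a * x) / x by field;
      rewrite lt0r_neq0.
    rewrite ler_pdivlMr //; apply: le_trans e3.
    have -> : a * x * Num.sqrt (a * x) * zeta32 R = a * x * d by rewrite dD;
      ring.
    rewrite -mulrBr [a * _]mulrC -mulrA [leLHS]mulrC ler_wpM2l //.
    by lra.
  apply: le_trans l1.
  rewrite -(ler_pM2r x0) [leRHS]mulrDl divfK ?lt0r_neq0 // mulrA -wE.
  rewrite -subr_ge0.
  have -> : x * x + w ^+ 2 * (1 - d) - 2 * w * (1 - d) * x =
            (x - w * (1 - d)) ^+ 2 + w ^+ 2 * ((1 - d) * d) by ring.
  by rewrite addr_ge0 ?sqr_ge0 // !mulr_ge0 ?sqr_ge0 //; lra.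
have u1 : x ^+ 2 <= (w * (1 + d)) ^+ 2.
  rewrite exprMn wE; apply: (@le_trans _ _ (a * (zeta2 R + d))).
    rewrite -(ler_pM2r x0) -exprSr hx.
    have : a * x * (zeta2 R - d)
      <= a * x * eta1 (a * x) by rewrite ler_wpM2l //; lra.
    by have -> : a * (zeta2 R + d) * x
      = 2 * (a * x * zeta2 R) - a * x * (zeta2 R - d); [ring|lra].
  rewrite -mulrA ler_pM2l //;
    have : 0 <= zeta2 R * d ^+ 2 by rewrite mulr_ge0 ?sqr_ge0 //; lra.
  by nra.
have u2 : x <= w * (1 + d).
  by rewrite -(ler_pXn2r (n := 2)) ?nnegrE ?(ltW x0) ?mulr_ge0 ?(ltW w0) //;
    lra.
apply: (@le_trans _ _ (2 * x)); last by rewrite -mulrA ler_pM2l.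
have -> : 2 * x = x + x by ring.
rewrite lerD2l mulrC ler_pdivrMr ?exprn_gt0 //; apply: le_trans hle _.
Qed.

(** A bound from below that does not depend on a, so that a x tends to
    infinity with a. *)
Lemma saddle_ge (a x : R) : 1 <= a -> saddle_point a x -> 1 / 2 <= x.
Proof.
move=> a1 sx; have a0 : 0 < a by lra.
have [x0 hx hle _] := saddle_bounds a0 sx.
rewrite leNgt; apply/negP => x12.
have t0 := ltW (mulr_gt0 a0 x0).
have := le_trans (onesubexpRN_ge_div t0) (le_trans (eta_ge_onesub t0) hle).
rewrite ler_pdivrMr; last by lra.
have x2 : x ^+ 2 <= 1 / 4 by rewrite expr2; nra.
have -> : x ^+ 3 * (1 + a * x) = x * (x ^+ 2 + a * x * x ^+ 2) by ring.
rewrite mulrC ler_pM2l // => h.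
have : a * x * x ^+ 2 <= a * (1 / 2) * (1 / 4).
  rewrite ler_pM ?mulr_ge0 ?sqr_ge0 ?(ltW a0) ?(ltW x0) //.
  by rewrite ler_pM2l // ltW.
by lra.
Qed.

(** For large a, eta (a x) differs from zeta(3) by an exponentially small
    amount, and so does x from y, the minimum point of x + zeta(3) / x^2,
    where this function takes the value 3 y / 2. Concavity of eta between a x
    / 2 and a x bounds the term with eta1. *)
Lemma growth_large (a x y d : R) : 1 <= a -> saddle_point a x ->
  0 < y -> y ^+ 3 = 2 * zeta3 R -> 16 <= a ->
  d = expR (- (a / 4)) ->
  3 / 2 * y * (1 - 2 * d) <= x + x ^- 2 * eta (a * x) <=
  3 / 2 * y * (1 + 2 * d * zeta3 R).
Proof.
move=> a1 sx y0 yE a16 dE; have a0 : 0 < a by lra.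
have [x0 hx hle hZ] := saddle_bounds a0 sx.
have xh := saddle_ge a1 sx; have Z := zeta3_ge1 R.
have t0 := ltW (mulr_gt0 a0 x0); have t20 : 0 <= a * x / 2 by lra.
have d0 : 0 < d by rewrite dE expR_gt0.
have dt : expR (- (a * x / 2)) <= d.
  by rewrite dE ler_expR lerN2; nra.
have d4 : d <= 1 / 4.
  have h := onesubexpRN_ge_div (t := a / 4); rewrite -dE in h.
  have {h} := h ltac:(lra).
  have : 4 / 5 <= a / 4 / (1 + a / 4) by rewrite ler_pdivlMr; lra.
  by lra.
have e1 : a * x * eta1 (a * x) <= 2 * d * zeta3 R.
  have := eta_tangent t20 t0; have := eta_ge_zeta3 t20; have := eta_le_zeta3 t0.
  have -> : a * x / 2 - a * x = - (a * x / 2) by field.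
  have : expR (- (a * x / 2)) * zeta3 R
    <= d * zeta3 R by rewrite ler_wpM2r //; lra.
  by rewrite mulNr; lra.
have e2 : zeta3 R * (1 - d) <= eta (a * x).
  have := eta_ge_zeta3 t0.
  have : expR (- (a * x)) <= d by apply: le_trans dt; rewrite ler_expR lerN2;
    lra.
  by nra.
have xE : y ^+ 3 * (1 - 2 * d) <= x ^+ 3 by rewrite hx yE; lra.
have xy : x <= y.
  by rewrite -(ler_pXn2r (n := 3)) ?nnegrE ?(ltW x0) ?(ltW y0) // yE.
have x1 : 1 <= x.
  rewrite -(ler_pXn2r (n := 3)) ?nnegrE ?(ltW x0) // expr1n.
  by apply: le_trans xE; rewrite yE; nra.
have y1 := le_trans x1 xy.
have te0 : 0 <= a * x * eta1 (a * x) by rewrite mulr_ge0 // eta1_ge0.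
have -> : x + x ^- 2 * eta (a * x)
  = 3 / 2 * x + a * x * eta1 (a * x) / (2 * x ^+ 2).
  have -> : eta (a * x) = (x ^+ 3 + a * x * eta1 (a * x)) / 2 by rewrite hx;
    field.
  by field; rewrite lt0r_neq0.
apply/andP; split.
  apply: (@le_trans _ _ (3 / 2 * x)); last first.
    by rewrite lerDl divr_ge0 // mulr_ge0 // sqr_ge0.
  rewrite -mulrA ler_pM2l; last by lra.
  rewrite -(ler_pM2r (exprn_gt0 2 y0)).
  have -> : y * (1 - 2 * d) * y ^+ 2 = y ^+ 3 * (1 - 2 * d) by ring.
  apply: le_trans xE _; rewrite exprS ler_wpM2l ?(ltW x0) //.
  by rewrite ler_pXn2r ?nnegrE ?(ltW x0) ?(ltW y0).
rewrite mulrDr mulr1; apply: lerD; first by lra.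
have q : 1 <= x ^+ 2 by apply: exprn_ege1.
rewrite ler_pdivrMr; last by rewrite mulr_gt0 ?exprn_gt0.
apply: le_trans e1 _.
have dZ : 0 <= 2 * d * zeta3 R by rewrite !mulr_ge0 ?(ltW d0) //; lra.
have -> : 3 / 2 * y * (2 * d * zeta3 R) * (2 * x ^+ 2)
  = 2 * d * zeta3 R * (3 * (y * x ^+ 2)) by field.
rewrite ler_peMr //.
have : 1 <= y * x ^+ 2 by apply: mulr_ege1.
by lra.
Qed.

End Growth.

Section Limits.
Variables (R : realType) (r : R -> R).
Hypothesis Hr : forall a : R, 0 < a -> saddle_point a (r a).

Lemma growth_cvg0 :
  growth r a / (2 * pi / Num.sqrt 6 * Num.sqrt a) @[a --> 0^'+] --> (1 : R).
Proof.
have Z32g := zeta32_ge1 R; have Z3g := zeta3_ge1 R; have Z2g := zeta2_ge1 R.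
apply/cvgrPdist_le => e e0.
have b0 : 0 < (e / zeta32 R) ^+ 2 / (2 * zeta3 R).
  by rewrite divr_gt0 ?exprn_gt0 ?divr_gt0 ?mulr_gt0 //; lra.
near=> a.
have a0 : 0 < a by near: a; exact: nbhs_right_gt.
have ab : a <= (e / zeta32 R) ^+ 2 / (2 * zeta3 R) by near: a;
  exact: nbhs_right_le.
have sa := Hr a0; have [x0 _ _ _] := saddle_bounds a0 sa.
have t0 := ltW (mulr_gt0 a0 x0).
have [d dE] : exists d, d = zeta32 R * Num.sqrt (a * r a) by eexists.
have [w wE] : exists w, w = Num.sqrt (a * zeta2 R) by eexists.
have de : d <= e.
  rewrite dE mulrC -ler_pdivlMr; last by lra.
  have eZ : 0 <= e / zeta32 R by rewrite divr_ge0 ?(ltW e0) //; lra.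
  rewrite -[leRHS](ger0_norm eZ) -sqrtr_sqr ler_wsqrtr //.
  rewrite ler_pdivlMr in ab; last by lra.
  apply: le_trans ab; rewrite ler_pM2l //; exact: saddle_le sa.
have w0 : 0 < w by rewrite wE sqrtr_gt0 mulr_gt0 //; lra.
have KE : 2 * pi / Num.sqrt 6 * Num.sqrt a = 2 * w.
  rewrite wE basel sqrtrM ?(ltW a0) // sqrtrM ?sqr_ge0 // sqrtr_sqr sqrtrV //.
  by rewrite ger0_norm ?pi_ge0 //; ring.
rewrite KE /growth.
have /andP[l u] := growth_small a0 sa wE dE.
have w20 : 0 < 2 * w by rewrite mulr_gt0.
have we : 2 * w * d <= 2 * w * e by rewrite ler_pM2l.
have q1 : (r a + r a ^- 2 * eta (a * r a)) / (2 * w) <= 1 + e.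
  by rewrite ler_pdivrMr //; lra.
have q2 : 1 - e <= (r a + r a ^- 2 * eta (a * r a)) / (2 * w).
  by rewrite ler_pdivlMr //; lra.
by rewrite ler_norml; lra.
Unshelve. all: by end_near. Qed.

Lemma growth_cvgy :
  growth r a / (3 * 2 `^ (- (2 / 3)) * zeta 3 `^ (1 / 3)) @[a --> +oo]
        --> (1 : R).
Proof.
have Z3g := zeta3_ge1 R; rewrite zeta3E.
have [y yE] : exists y, y = 2 `^ (1 / 3) * zeta3 R `^ (1 / 3) :> R by eexists.
have Z30 : 0 < zeta3 R by lra.
have y0 : 0 < y by rewrite yE mulr_gt0 // powR_gt0.
have cube (b : R) : 0 < b -> (b `^ (1 / 3)) ^+ 3 = b.
  move=> b0; rewrite -powR_mulrn ?powR_ge0 // -powRrM.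
  by rewrite (_ : 1 / 3 * 3%:R = 1) ?powRr1 ?ltW //; field.
have y3 : y ^+ 3 = 2 * zeta3 R by rewrite yE exprMn !cube.
have KE : 3 * 2 `^ (- (2 / 3)) * zeta3 R `^ (1 / 3) = 3 / 2 * y.
  have -> : - (2 / 3) = 1 / 3 - 1 :> R by field.
  rewrite powRD; last by apply/implyP.
  by rewrite powR_inv1 // yE; ring.
rewrite KE; apply/cvgrPdist_le => e e0.
near=> a.
have a16 : 16 <= a by near: a; apply: nbhs_pinfty_ge; exact: num_real.
have ab : 8 * zeta3 R / e <= a by near: a; apply: nbhs_pinfty_ge;
  exact: num_real.
have a0 : 0 < a by lra. have a1 : 1 <= a by lra.
have sa := Hr a0.
have [d dE] : exists d, d = expR (- (a / 4)) by eexists.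
have /andP[l u] := growth_large a1 sa y0 y3 a16 dE.
have d0 : 0 < d by rewrite dE expR_gt0.
have da : d * (a / 4) <= 1.
  rewrite dE; have := expR_ge1Dx (a / 4);
    have : expR (a / 4) * expR (- (a / 4)) = 1.
    by rewrite -expRD subrr expR0.
  by have := expR_gt0 (- (a / 4)); nra.
have de : 2 * d * zeta3 R <= e.
  rewrite ler_pdivrMr // in ab.
  have : d * (8 * zeta3 R) <= d * (a * e) by rewrite ler_pM2l.
  have : d * (a / 4) * e <= 1 * e by rewrite ler_pM2r.
  by lra.
have y20 : 0 < 3 / 2 * y by rewrite mulr_gt0.
rewrite /growth.
have : 3 / 2 * y * (2 * d * zeta3 R) <= 3 / 2 * y * e by rewrite ler_pM2l.
have : 3 / 2 * y * (2 * d) <= 3 / 2 * y * (2 * d * zeta3 R).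
  by rewrite ler_pM2l // ler_peMr // mulr_ge0 // ltW.
move=> h1 h2.
have q1 : (r a + r a ^- 2 * eta (a * r a)) / (3 / 2 * y) <= 1 + e.
  by rewrite ler_pdivrMr //; lra.
have q2 : 1 - e <= (r a + r a ^- 2 * eta (a * r a)) / (3 / 2 * y).
  by rewrite ler_pdivlMr //; lra.
by rewrite ler_norml; lra.
Unshelve. all: by end_near. Qed.

End Limits.

(** * The series of the logarithm *)

Section LogSeries.
Variable R : realType.

Definition ln_partial (K : nat) (x : R) : R := \sum_(l < K) x ^+ l.+1 / l.+1%:R.

Lemma is_derive_ln_partial K (x : R) :
  is_derive x 1 (ln_partial K) (\sum_(l < K) x ^+ l).
Proof.
elim: K => [|K IH].
  rewrite big_ord0 (_ : ln_partial 0 = cst 0); first exact: is_derive_cst.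
  by apply/funext => y; rewrite /ln_partial big_ord0.
rewrite (_ : ln_partial K.+1 =
             ln_partial K + (K.+1%:R^-1 *: (id : R -> R) ^+ K.+1)).
  rewrite big_ord_recr /=; apply: is_deriveD.
  apply: is_derive_eq; rewrite /GRing.scale /= mulr1.
  by rewrite mulrnAl mulrnAr -mulr_natr mulrAC mulVf ?mul1r ?pnatr_eq0.
apply/funext => y; rewrite /ln_partial big_ord_recr /=; congr (_ + _).
by rewrite mulrC; congr (_ * _); rewrite fctE.
Qed.

(** The remainder has derivative x^K / (1 - x), which is nonnegative and
    largest at the right end y. *)
Lemma ln_partial_bounds K (y : R) : 0 <= y < 1 ->
  0 <= - ln (1 - y) - ln_partial K y <= y ^+ K / (1 - y).
Proof.
move=> /andP[y0 y1].
have geo (x : R) : x < 1 -> (1 - x)^-1 - \sum_(l < K) x ^+ l = x ^+ K / (1 - x).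
  move=> x1; have x10 : 1 - x != 0 by rewrite subr_eq0 eq_sym lt_eqF.
  have E : (1 - x) * \sum_(l < K) x ^+ l = 1 - x ^+ K.
    by rewrite -opprB mulNr -subrX1 opprB.
  apply: (mulfI x10); rewrite mulrBr E mulfV //.
  by rewrite mulrCA mulfV // mulr1; ring.
pose C := y ^+ K / (1 - y); pose f (x : R) : R := - ln (1 - x) - ln_partial K x.
have D (x : R) : 0 <= x <= y -> is_derive x 1 f (x ^+ K / (1 - x)).
  move=> /andP[x0 xy]; rewrite -geo; last by lra.
  have x1 : 0 < 1 - x by lra.
  have d1 : is_derive x 1 (fun x : R => 1 - x) (-1).
    by apply: is_derive_eq; rewrite add0r mul1r.
  have d2 := @is_derive1_comp R (@ln R) (fun x =>
    1 - x) x _ _ (is_derive1_ln x1) d1.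
  have d3 := @is_deriveB _ _ _ _ _ _ _ _ _ (@is_deriveN _ _ _ _ _ _ _ d2)
               (is_derive_ln_partial K x).
  rewrite (_ : f = - (@ln R \o (fun x => 1 - x)) - ln_partial K) //.
  by apply: (is_derive_eq d3); rewrite mulrN1 opprK.
have f0 : f 0 = 0.
  rewrite /f subr0 ln1 oppr0 sub0r /ln_partial big1 ?oppr0 // => l _.
  by rewrite expr0n mul0r.
have dC (x : R) : 0 <= x <= y -> 0 <= x ^+ K / (1 - x) <= C.
  move=> /andP[x0 xy]; have x1 : 0 < 1 - x by lra.
  rewrite divr_ge0 ?exprn_ge0 ?(ltW x1) //= /C.
  rewrite ler_pM ?exprn_ge0 ?invr_ge0 ?(ltW x1) //; first exact: lerXn2r.
  by rewrite lef_pV2 ?posrE //; lra.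
apply/andP; split.
  rewrite -[X in X <= _]f0; apply: ge0_is_derive_le y0 D _ => x /dC /andP[] //.
have : C * 0 - f 0 <= C * y - f y.
  apply: (ge0_is_derive_le (f := fun x => C * x - f x)
    (df := fun x => C - x ^+ K / (1 - x)) y0) => x xy.
    have dx := D x xy.
    have dc : is_derive x 1 (fun x : R => C * x) C.
      by apply: is_derive_eq; rewrite /GRing.scale /= ?mulr1.
    exact: is_deriveB.
  by have /andP[] := dC x xy; rewrite subr_ge0.
rewrite f0 mulr0 subr0 subr_ge0 => h; apply: le_trans h _.
have /andP[C0 _] := dC y ltac:(by rewrite y0 lexx).
by rewrite ler_piMr // ltW.
Qed.

Lemma cvg_ln_series (y : R) : 0 <= y < 1 ->
  series (fun l => y ^+ l.+1 / l.+1%:R) @ \oo --> - ln (1 - y).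
Proof.
move=> y01; have /andP[y0 y1] := y01.
apply: (@squeeze_cvgr _ _ _ _ (fun K => - ln (1 - y) - y ^+ K / (1 - y))
   (fun=> - ln (1 - y))).
- near=> K; rewrite seriesEord /=.
  by have /andP[] := ln_partial_bounds K y01; rewrite /ln_partial; lra.
- rewrite -[X in _ --> X]subr0; apply: cvgB; first exact: cvg_cst.
  rewrite -(mul0r (1 - y)^-1); apply: cvgMl.
  by apply: cvg_expr; rewrite ger0_norm.
- exact: cvg_cst.
Unshelve. all: by end_near. Qed.

End LogSeries.

(** * The logarithm of the generating function *)

Section GeneratingFunction.
Variable R : realType.
Local Notation c j := (j.+1%:R : R).
Implicit Type tau : R.

(** The generating function of plane partitions with at most m rows and n
    columns at exp (- tau). Truncating to n columns is harmless, since all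
    plane partitions of n have at most n columns. *)
Definition box_prod (m n : nat) (tau : R) : R :=
  \prod_(p : 'I_m * 'I_n)
    (1 - expR (- tau) ^+ box_weight m n p.1 p.2)^-1.

Lemma expRN_pow_lt1 (tau : R) k : 0 < tau -> (0 < k)%N ->
  0 <= expR (- tau) ^+ k < 1.
Proof.
move=> t0 k0; rewrite exprn_ge0 ?expR_ge0 //=.
by rewrite exprn_ilt1 ?expR_ge0 ?expR_lt1 ?oppr_lt0 // -lt0n.
Qed.

Lemma box_weight_gt0 m n (i : 'I_m) (j : nat) : (0 < box_weight m n i j)%N.
Proof. by rewrite /box_weight; have := ltn_ord i; lia. Qed.

(** Two geometric sums: the rows contribute m - i and the columns n - j - 1.
    *)
Lemma sum_box_weight m n (y : R) : y != 1 ->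
  \sum_(p : 'I_m * 'I_n) y ^+ box_weight m n p.1 p.2 =
  y * (1 - y ^+ m) * (1 - y ^+ n) / (1 - y) ^+ 2.
Proof.
move=> y1; have y10 : 1 - y != 0 by rewrite subr_eq0 eq_sym.
have geo k : \sum_(i < k) y ^+ i = (1 - y ^+ k) / (1 - y).
  apply: (mulfI y10); rewrite mulrCA mulfV // mulr1.
  by rewrite -opprB mulNr -subrX1 opprB.
have h1 : \sum_(i < m) y ^+ (m - i) = y * (1 - y ^+ m) / (1 - y).
  rewrite (reindex_inj rev_ord_inj) /= -mulrA -geo big_distrr /=.
  by apply: eq_bigr => i _; rewrite -exprS; congr (_ ^+ _);
    have := ltn_ord i; lia.
have h2 : \sum_(j < n) y ^+ (n - j.+1) = (1 - y ^+ n) / (1 - y).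
  rewrite (reindex_inj rev_ord_inj) /= -geo.
  by apply: eq_bigr => i _; congr (_ ^+ _); have := ltn_ord i; lia.
have -> : y * (1 - y ^+ m) * (1 - y ^+ n) / (1 - y) ^+ 2 =
   y * (1 - y ^+ m) / (1 - y) * ((1 - y ^+ n) / (1 - y)).
  by field.
rewrite -h1 -h2 big_distrlr pair_bigA; apply: eq_bigr => -[i j] _ /=.
by rewrite -exprD.
Qed.

(** The l-th powers in the series of the logarithms of all factors of the
    product, gathered. *)
Definition log_term (m n : nat) (tau : R) (l : nat) : R :=
  \sum_(p : 'I_m * 'I_n)
    (expR (- tau) ^+ box_weight m n p.1 p.2) ^+ l.+1 / c l.

Lemma cvg_log_term m n tau : 0 < tau ->
  series (log_term m n tau) @ \oo --> ln (box_prod m n tau).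
Proof.
move=> t0; pose q (p : 'I_m * 'I_n) := expR (- tau) ^+ box_weight m n p.1 p.2.
have q01 p : 0 <= q p < 1 by apply: expRN_pow_lt1 => //; apply: box_weight_gt0.
have [_ ->] : 0 < box_prod m n tau /\
    ln (box_prod m n tau) = \sum_p - ln (1 - q p).
  rewrite /box_prod.
  apply: (big_rec2 (fun x y => 0 < x /\ ln x = y)) => [|p x y _ [x0 <-]].
    by rewrite ln1.
  have q1 : 0 < 1 - q p by have /andP[_] := q01 p; rewrite subr_gt0.
  by rewrite mulr_gt0 ?invr_gt0 // lnM ?posrE ?invr_gt0 // lnV.
have -> : series (log_term m n tau) =
    (fun N => \sum_p series (fun l => q p ^+ l.+1 / c l) N).
  apply/funext => N; rewrite seriesEord /log_term /= exchange_big /=.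
  by apply: eq_bigr => p _; rewrite seriesEord.
apply: (@cvg_big _ _ _ _ _ (@add_continuous R)) => p _.
exact: cvg_ln_series.
Qed.

Lemma box_prod_gt0 m n tau : 0 < tau -> 0 < box_prod m n tau.
Proof.
move=> t0; apply: prodr_gt0 => p _; rewrite invr_gt0 subr_gt0.
by have /andP[] := expRN_pow_lt1 t0 (box_weight_gt0 n p.1 p.2).
Qed.

(** With y = exp (- l tau) the geometric sums of [sum_box_weight] make the
    dependence on m explicit as 1 - y^m. *)
Lemma log_termE m n tau l : 0 < tau ->
  log_term m n tau l =
  expR (- (c l * tau)) * (1 - expR (- (c l * (m%:R * tau))))
  * (1 - expR (- (c l * (n%:R * tau)))) / (1 - expR (- (c l * tau))) ^+ 2 / c l.
Proof.
move=> t0; rewrite /log_term -big_distrl /=; congr (_ / _).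
have y1 : expR (- (c l * tau)) != 1.
  by rewrite lt_eqF // expR_lt1 oppr_lt0 mulr_gt0.
have ye k : expR (- (c l * (k%:R * tau))) = expR (- (c l * tau)) ^+ k.
  by rewrite -expRM_natl; congr expR; ring.
rewrite !ye -sum_box_weight //; apply: eq_bigr => p _.
by rewrite -mulrN expRM_natl -!exprM mulnC.
Qed.

Lemma log_term_le m n tau l : 0 < tau ->
  log_term m n tau l <=
  tau ^- 2 * ((1 - expR (- (c l * (m%:R * tau)))) / c l ^+ 3).
Proof.
move=> t0; rewrite log_termE //.
have u0 : 0 < c l * tau by rewrite mulr_gt0.
have A := expRN_div_sqr_le (ltW u0).
have ge0 k : 0 <= 1 - expR (- (c l * (k%:R * tau))).
  by rewrite onesubexpRN_ge0 // !mulr_ge0 // ltW.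
have c0 : 0 < c l by [].
have -> : tau ^- 2 * ((1 - expR (- (c l * (m%:R * tau)))) / c l ^+ 3) =
   (1 - expR (- (c l * (m%:R * tau)))) / (c l * tau) ^+ 2 / c l.
  by field; rewrite !lt0r_neq0.
rewrite ler_wpM2r ?invr_ge0 //.
have d0 : 0 < 1 - expR (- (c l * tau)) by rewrite subr_gt0 expR_lt1 oppr_lt0.
rewrite ler_pdivrMr ?exprn_gt0 // [leRHS]mulrAC ler_pdivlMr ?exprn_gt0 //.
have : 1 - expR (- (c l * (n%:R * tau))) <= 1 by rewrite gerBl expR_ge0.
have := ge0 m; have := ge0 n; have := expR_gt0 (- (c l * tau)).
move: A; move: (expR (- (c l * tau))) (1 - expR (- (c l * (n%:R * tau))))
  (1 - expR (- (c l * (m%:R * tau)))) => y N M A y0 N0 M0 N1.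
have h : M * ((c l * tau) ^+ 2 * y) <= M * (1 - y) ^+ 2 by rewrite ler_wpM2l.
apply: le_trans h.
have -> : y * M * N * (c l * tau) ^+ 2 = M * ((c l * tau) ^+ 2 * y) * N by ring.
by rewrite ler_piMr // !mulr_ge0 ?sqr_ge0 // ltW.
Qed.

(** Two factors are given up. The truncation to n columns costs 1 - exp (- n
    tau), and replacing exp (- l tau) by 1 costs at most sqrt (l tau), which
    is summable against l^(-3/2) thanks to Bernoulli's inequality for 1 - exp
    (- l m tau). *)
Lemma log_term_ge m n tau B l : (0 < n)%N -> 0 < tau ->
  B = (1 - expR (- (n%:R * tau))) / tau ^+ 2 ->
  B * ((1 - expR (- (c l * (m%:R * tau)))) / c l ^+ 3)
  + - (B * Num.sqrt tau * (1 - expR (- (m%:R * tau)))) * inv32 R l <=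
  log_term m n tau l.
Proof.
move=> n0 t0 BE; rewrite log_termE //.
have c0 : 0 < c l by []. have c1 : 1 <= c l by rewrite ler1n.
have u0 : 0 < c l * tau by rewrite mulr_gt0.
have mt : 0 <= m%:R * tau by rewrite mulr_ge0 // ltW.
have nt : 0 <= n%:R * tau by rewrite mulr_ge0 // ltW.
have B0 : 0 <= B by rewrite BE divr_ge0 ?sqr_ge0 ?onesubexpRN_ge0.
(* the middle term still has the factor exp (- l tau) *)
apply: (@le_trans _ _ (B * (expR (- (c l * tau))
          * (1 - expR (- (c l * (m%:R * tau))))) / c l ^+ 3)).
  have q0 := sqrt_nat_gt0 R l;
    have qE : Num.sqrt (c l) ^+ 2 = c l by rewrite sqr_sqrtr.
  have h1 : 1 - expR (- (c l * tau)) <= Num.sqrt (c l) * Num.sqrt tau.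
    by rewrite -sqrtrM // onesubexpRN_le_sqrt // ltW.
  have h2 : 1 - expR (- (c l * (m%:R * tau)))
    <= c l * (1 - expR (- (m%:R * tau))).
    rewrite -mulrN expRM_natl; apply: bernoulli_sub.
    by rewrite expR_ge0 expRN_le1.
  have g1 := onesubexpRN_ge0 (ltW u0).
  have g2 : 0 <= 1 - expR (- (c l * (m%:R * tau))).
    by rewrite onesubexpRN_ge0 // mulr_ge0.
  have g3 := ler_pM g1 g2 h1 h2.
  rewrite -subr_ge0.
  have -> : B * (expR (- (c l * tau)) * (1 - expR (- (c l * (m%:R * tau)))))
    / c l ^+ 3
   - (B * ((1 - expR (- (c l * (m%:R * tau)))) / c l ^+ 3)
   + - (B * Num.sqrt tau * (1 - expR (- (m%:R * tau)))) * inv32 R l)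
   = B * (Num.sqrt (c l) * Num.sqrt tau * (c l * (1 - expR (- (m%:R * tau))))
      - (1 - expR (- (c l * tau))) * (1 - expR (- (c l * (m%:R * tau))))) / c
        l ^+ 3.
    rewrite /inv32; move: q0 qE; move: (Num.sqrt (c l)) => q q0 <-.
    by field; rewrite lt0r_neq0.
  by rewrite divr_ge0 ?exprn_ge0 // mulr_ge0 // subr_ge0.
rewrite BE.
have d0 : 0 < 1 - expR (- (c l * tau)) by rewrite subr_gt0 expR_lt1 oppr_lt0.
have h1 : 1 - expR (- (n%:R * tau)) <= 1 - expR (- (c l * (n%:R * tau))).
  by rewrite lerD2l lerN2 ler_expR lerN2 ler_peMl.
have h2 : (1 - expR (- (c l * tau))) ^+ 2 <= (c l * tau) ^+ 2.
  by rewrite ler_pXn2r ?nnegrE ?(ltW d0) ?(ltW u0) ?onesubexpRN_le.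
have g0 : 0 <= expR (- (c l * tau)) * (1 - expR (- (c l * (m%:R * tau)))).
  by rewrite mulr_ge0 ?expR_ge0 // onesubexpRN_ge0 // mulr_ge0.
have gn := onesubexpRN_ge0 nt.
move: g0 h1 h2 gn d0;
  move: (1 - expR (- (c l * tau))) (1 - expR (- (n%:R * tau)))
  (1 - expR (- (c l * (n%:R * tau)))) (expR _ * _) => D N N' Y Y0 NN D2 N0 D0.
have -> : N / tau ^+ 2 * Y / c l ^+ 3 = Y * N / (c l * tau) ^+ 2 / c l.
  by field; rewrite !lt0r_neq0.
rewrite ler_wpM2r ?invr_ge0 ?(ltW c0) //.
apply: ler_pM; rewrite ?mulr_ge0 ?invr_ge0 ?sqr_ge0 //.
  by rewrite ler_wpM2l.
by rewrite lef_pV2 ?posrE ?exprn_gt0.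
Qed.

(** No error term is present here, so the upper half of the asymptotics is an
    exact inequality. *)
Lemma ln_box_prod_le m n tau : 0 < tau ->
  ln (box_prod m n tau) <= tau ^- 2 * eta (m%:R * tau).
Proof.
move=> t0; have cl := @cvg_log_term m n tau t0.
have mt : 0 <= m%:R * tau by rewrite mulr_ge0 // ltW.
rewrite -(cvg_lim _ cl) //.
have := lim_series_le_lin (cvgP _ cl) (cvg_eta mt) (cvg_eta mt) (a :=
  tau ^- 2) (b := 0).
rewrite mul0r addr0; apply => l.
by rewrite mul0r addr0; exact: log_term_le.
Qed.

(** The relative error tends to 0 with tau, uniformly in m: this is where the
    uniformity of the final estimate comes from. *)
Lemma ln_box_prod_ge m n tau : (0 < n)%N -> 0 < tau ->
  (1 - expR (- (n%:R * tau))) * (1 - Num.sqrt tau * zeta32 R)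
    * (tau ^- 2 * eta (m%:R * tau)) <= ln (box_prod m n tau).
Proof.
move=> n0 t0; have cl := @cvg_log_term m n tau t0.
have mt : 0 <= m%:R * tau by rewrite mulr_ge0 // ltW.
have nt : 0 <= n%:R * tau by rewrite mulr_ge0 // ltW.
rewrite -(cvg_lim _ cl) //.
have [B BE] : exists B, B = (1 - expR (- (n%:R * tau))) / tau ^+ 2 by eexists.
have B0 : 0 <= B by rewrite BE divr_ge0 ?sqr_ge0 ?onesubexpRN_ge0.
have H := lim_series_ge_lin (cvgP _ cl) (cvg_eta mt) (@cvg_inv32 R)
  (fun l => log_term_ge m l n0 t0 BE).
apply: le_trans H; rewrite -/(eta _) -/(zeta32 R).
have e1 := eta_ge_onesub mt; have Z := zeta32_ge1 R.
have Z0 : 0 <= zeta32 R by lra.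
have h : 0 <= B * Num.sqrt tau * zeta32 R * (eta (m%:R * tau) - (1 - expR (-
  (m%:R * tau)))).
  by rewrite !mulr_ge0 ?sqrtr_ge0 // subr_ge0.
have -> : (1 - expR (- (n%:R * tau))) * (1 - Num.sqrt tau * zeta32 R)
    * (tau ^- 2 * eta (m%:R * tau))
      = B * (1 - Num.sqrt tau * zeta32 R) * eta (m%:R * tau).
  by rewrite BE; ring.
by lra.
Qed.

End GeneratingFunction.

(** * Counting through the generating function *)

Section Counting.
Variables (R : realType) (m n : nat).
Implicit Type tau : R.

(** The generating function with entries of arrays bounded by K, a finite sum.
    *)
Definition trunc_gf (K : nat) (tau : R) : R :=
  \sum_(f : {ffun 'I_m * 'I_n -> 'I_K.+1}) expR (- tau) ^+ ffun_weight f.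

Lemma trunc_gfE K tau : 0 < tau ->
  trunc_gf K tau =
  (\prod_(p : 'I_m * 'I_n)
     (1 - (expR (- tau) ^+ box_weight m n p.1 p.2) ^+ K.+1)) * box_prod m n tau.
Proof.
move=> t0; rewrite /box_prod -big_split /=.
transitivity (\prod_(p : 'I_m * 'I_n) \sum_(a < K.+1)
    (expR (- tau) ^+ box_weight m n p.1 p.2) ^+ a); last first.
  apply: eq_bigr => p _;
    have /andP[_] := expRN_pow_lt1 t0 (box_weight_gt0 n p.1 p.2).
  move: (expR _ ^+ _) => y y1;
    have y10 : 1 - y != 0 by rewrite subr_eq0 eq_sym lt_eqF.
  apply: (mulfI y10); rewrite mulrCA mulfV // mulr1.
  by rewrite -opprB mulNr -subrX1 opprB.
rewrite bigA_distr_bigA; apply: eq_bigr => f _.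
rewrite /ffun_weight -prodrXr; apply: eq_bigr => p _.
by rewrite -exprM mulnC.
Qed.

Lemma trunc_gf_le K tau : 0 < tau -> trunc_gf K tau <= box_prod m n tau.
Proof.
move=> t0; rewrite trunc_gfE // ler_piMl ?(ltW (box_prod_gt0 _ _ t0)) //.
apply: prodr_ile1 => p _.
have /andP[y0 y1] := expRN_pow_lt1 t0 (box_weight_gt0 n p.1 p.2).
by rewrite subr_ge0 exprn_ile1 ?(ltW y1) //= gerBl exprn_ge0.
Qed.

(** Truncating the entries multiplies each factor of the product by 1 - q^(w
    (K + 1)), and this tends to 1 as K grows. *)
Lemma trunc_gf_half tau : 0 < tau ->
  exists2 K, (n <= K)%N & box_prod m n tau / 2 <= trunc_gf K tau.
Proof.
move=> t0; have /andP[q0 q1] := expRN_pow_lt1 t0 (ltn0Sn 0).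
rewrite expr1 in q0 q1; set q := expR (- tau) in q0 q1 *.
pose N := #|{: 'I_m * 'I_n}|.
have cN : (N%:R * q ^+ k) @[k --> \oo] --> (0 : R).
  rewrite -[X in _ --> X](mulr0 N%:R); apply: cvgMr.
  by apply: cvg_expr; rewrite ger0_norm.
have [K0 _ hK] : \forall k \near \oo, N%:R * q ^+ k < 1 / 2.
  by apply: cvgr_lt cN _ _; rewrite divr_gt0.
exists (maxn n K0); first exact: leq_maxl.
set K := maxn n K0; have := hK K (leq_maxr _ _) => {}hK.
rewrite trunc_gfE // mulrC ler_pM2r ?box_prod_gt0 //.
have qK0 : 0 <= q ^+ K.+1 by apply: exprn_ge0.
have qK1 : q ^+ K.+1 <= 1 by apply: exprn_ile1 => //; exact: ltW.
apply: (@le_trans _ _ (\prod_(p : 'I_m * 'I_n) (1 - q ^+ K.+1))); last first.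
  apply: ler_prod => p _; rewrite subr_ge0 qK1 /= lerD2l lerN2 -exprM.
  by rewrite ler_wiXn2l ?(ltW q1) // leq_pmull // box_weight_gt0.
rewrite prodr_const.
have := @bernoulli_sub R (1 - q ^+ K.+1) N;
  rewrite subr_ge0 qK1 gerBl qK0 => /(_ isT).
rewrite subKr => h.
have : N%:R * q ^+ K.+1 <= N%:R * q ^+ K.
  by rewrite ler_wpM2l // exprS ler_piMl ?exprn_ge0 // ltW.
by rewrite /N in h hK *; lra.
Qed.

Hypotheses (m0 : (0 < m)%N) (mn : (m <= n)%N).
Local Notation H := (plane_partitions n m).

(** A single term of a series with nonnegative terms is at most its sum. *)
Lemma plane_partitions_upper tau : 0 < tau ->
  H%:R * expR (- tau) ^+ n <= box_prod m n tau.
Proof.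
move=> t0; apply: le_trans (trunc_gf_le n t0).
rewrite (plane_partitionsE mn (leqnn n)) /trunc_gf.
rewrite (bigID (fun f => ffun_weight f == n)) /=.
apply: (@le_trans _ _ (\sum_(f : {ffun 'I_m * 'I_n -> 'I_n.+1} | ffun_weight
  f == n)
    expR (- tau) ^+ n)).
  by rewrite sumr_const mulr_natl.
rewrite -[X in X <= _]addr0; apply: lerD; last first.
  by apply: sumr_ge0 => f _; rewrite exprn_ge0 ?expR_ge0.
by apply: ler_sum => f /eqP ->.
Qed.

Lemma box_weight_le1 : exists p : 'I_m * 'I_n, box_weight m n p.1 p.2 = 1%N.
Proof.
have n0 : (0 < n)%N by exact: leq_trans mn.
have hm : (m.-1 < m)%N by rewrite prednK. have hn : (n.-1 < n)%N by rewrite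
  prednK.
by exists (Ordinal hm, Ordinal hn); rewrite /box_weight /=; lia.
Qed.

(** Adding n - N to the box of weight 1 is injective, so the number of arrays
    of a given weight is nondecreasing in the weight. *)
Lemma card_weight_le K N : (n <= K)%N -> (N <= n)%N ->
  (#|[pred f : {ffun 'I_m * 'I_n -> 'I_K.+1} | ffun_weight f == N]| <= H)%N.
Proof.
move=> nK Nn; rewrite (plane_partitionsE mn nK).
have [p0 p0E] := box_weight_le1.
pose g (f : {ffun 'I_m * 'I_n -> 'I_K.+1}) : {ffun 'I_m * 'I_n -> 'I_K.+1} :=
  [ffun p => if p == p0 then inord (f p0 + (n - N)) else f p].
have bd (f : {ffun 'I_m * 'I_n -> 'I_K.+1}) : ffun_weight f = N ->
    (f p0 + (n - N) < K.+1)%N.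
  move=> fN; have : (f p0 <= N)%N.
    by rewrite -fN /ffun_weight (bigD1 p0) //= p0E muln1 leq_addr.
  by lia.
have gi : {in [pred f | ffun_weight f == N] &, injective g}.
  move=> f1 f2; rewrite !inE => /eqP h1 /eqP h2 E; apply/ffunP => p.
  move/ffunP/(_ p): E; rewrite /g !ffunE; case: eqP => [->|//].
  move=> /(congr1 val); rewrite /= !inordK ?bd // => /addIn e.
  exact: val_inj.
rewrite -(card_in_imset gi); apply: subset_leq_card; apply/fintype.subsetP => h.
case/imsetP => f; rewrite !inE => /eqP fN ->;
  rewrite /ffun_weight (bigD1 p0) //=.
rewrite /g ffunE eqxx inordK ?bd // p0E muln1.
rewrite (eq_bigr (fun p => f p * box_weight m n p.1 p.2)%N); last first.
  by move=> p /negbTE pp; rewrite ffunE pp.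
move: fN; rewrite /ffun_weight (bigD1 p0) //= p0E muln1 => fN.
by rewrite -[X in _ == X](subnK Nn) -fN; apply/eqP; lia.
Qed.

Lemma card_weight_sum K : (n <= K)%N ->
  (#|[pred f : {ffun 'I_m * 'I_n -> 'I_K.+1} | ffun_weight f <= n]|
    <= n.+1 * H)%N.
Proof.
move=> nK.
have -> : (#|[pred f : {ffun 'I_m * 'I_n -> 'I_K.+1} | ffun_weight f <= n]|)%N =
  (\sum_(N < n.+1) #|[pred f : {ffun 'I_m * 'I_n -> 'I_K.+1} | ffun_weight f
    == N]|)%N.
  rewrite -sum1_card.
  rewrite (partition_big (fun f => inord (ffun_weight f) : 'I_n.+1) predT) //=.
  apply: eq_bigr => N _; rewrite -sum1_card; apply: eq_bigl => f; rewrite !inE.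
  apply/andP/eqP => [[fn /eqP <-]|->]; first by rewrite inordK.
  by rewrite -ltnS ltn_ord inord_val.
rewrite -[X in (_ <= X * _)%N]card_ord -sum_nat_const; apply: leq_sum => N _.
by apply: card_weight_le => //; rewrite -ltnS.
Qed.

(** Chernoff's method. In the sum at t2, the arrays of weight above n are
    compared with the sum at the smaller parameter t1, those of weight below b
    with the sum at the larger parameter t3; the arrays in between are counted
    by [card_weight_sum]. *)
Lemma plane_partitions_lower (t1 t2 t3 b : R) : 0 < t1 -> t1 <= t2 -> t2
  <= t3 ->
  box_prod m n t2 / 2 <=
  (n.+1 * H)%:R * expR (- (t2 * b))
  + expR (- ((t2 - t1) * n%:R)) * box_prod m n t1
  + expR ((t3 - t2) * b) * box_prod m n t3.
Proof.
move=> t10 t12 t23; have t20 : 0 < t2 by lra. have t30 : 0 < t3 by lra.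
have [K nK hK] := trunc_gf_half t20; apply: le_trans hK _.
apply: (@le_trans _ _ (
  \sum_(f : {ffun 'I_m * 'I_n -> 'I_K.+1} | (ffun_weight f
    <= n)%N) expR (- (t2 * b))
  + expR (- ((t2 - t1) * n%:R)) * trunc_gf K t1
  + expR ((t3 - t2) * b) * trunc_gf K t3)); last first.
  apply: lerD; last by rewrite ler_wpM2l ?expR_ge0 ?trunc_gf_le.
  apply: lerD; last by rewrite ler_wpM2l ?expR_ge0 ?trunc_gf_le.
  by rewrite sumr_const -[X in X
    <= _]mulr_natl ler_wpM2r ?expR_ge0 // ler_nat card_weight_sum.
rewrite /trunc_gf !big_distrr /= [X in X + _ + _]big_mkcond -!big_split /=.
apply: ler_sum => f _; move: (ffun_weight f) => w.
have E (t : R) : expR (- t) ^+ w = expR (- (t * w%:R)).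
  by rewrite -expRM_natl; congr expR; ring.
rewrite !E -!expRD.
have e1 := expR_ge0 (- ((t2 - t1) * n%:R) + - (t1 * w%:R)).
have e2 := expR_ge0 ((t3 - t2) * b + - (t3 * w%:R)).
(* each term is bounded by one of the three summands *)
have [wn|nw] := leqP w n; last first.
  have : expR (- (t2 * w%:R)) <= expR (- ((t2 - t1) * n%:R) + - (t1 * w%:R)).
    rewrite ler_expR; have : (t2 - t1) * n%:R <= (t2 - t1) * w%:R.
      by rewrite ler_wpM2l ?subr_ge0 // ler_nat ltnW.
    by lra.
  by lra.
have [wb|bw] := leP b w%:R.
  have : expR (- (t2 * w%:R)) <= expR (- (t2 * b)).
    by rewrite ler_expR lerN2 ler_pM2l.
  by lra.
have : expR (- (t2 * w%:R)) <= expR ((t3 - t2) * b + - (t3 * w%:R)).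
  rewrite ler_expR; have : (t3 - t2) * w%:R <= (t3 - t2) * b.
    by rewrite ler_wpM2l ?subr_ge0 // ltW.
  by lra.
have := expR_ge0 (- (t2 * b)); lra.
Qed.

End Counting.

(** * The uniform asymptotics *)

Lemma inv1D_ge (R : realType) (d : R) : 0 <= d <= 1 ->
  1 - d + d ^+ 2 / 2 <= (1 + d)^-1.
Proof.
move=> /andP[d0 d1]; have p : 0 < 1 + d by lra.
rewrite -(ler_pM2r p) mulVf ?lt0r_neq0 //.
have : 0 <= d * d * (1 - d) by rewrite !mulr_ge0 // subr_ge0.
by rewrite expr2; nra.
Qed.

(** The left side is be - 2 d up to terms of second order in d. *)
Lemma tilted_exponent_le (R : realType) (be d : R) : 1 / 2 <= be -> 0 <= d ->
  (be + 2 * d * (2 * be - 1)) / (1 + 2 * d) ^+ 2 <= be - 2 * d + 8 * d ^+ 2.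
Proof.
move=> be1 d0; have p : 0 < 1 + 2 * d by lra.
rewrite ler_pdivrMr ?exprn_gt0 //.
have d3 : 0 <= d ^+ 3 by rewrite exprn_ge0.
have d4 : 0 <= d ^+ 4 by rewrite exprn_ge0.
have bd : 0 <= (be - 1 / 2) * d ^+ 2 by rewrite mulr_ge0 ?subr_ge0 ?sqr_ge0.
have d2 : 0 <= d ^+ 2 by rewrite sqr_ge0.
have -> : (be - 2 * d + 8 * d ^+ 2) * (1 + 2 * d) ^+ 2 =
  be + 2 * d * (2 * be - 1) + 4 * be * d ^+ 2 + 24 * d ^+ 3
    + 32 * d ^+ 4 by ring.
by lra.
Qed.

(** Normalised value of eta at the saddle point: in terms of it all exponents
    below become multiples of x nu^2, and it always lies in [1/2, 1]. *)
Definition saddle_ratio (R : realType) (a x : R) : R := eta (a * x) / x ^+ 3.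

Section Uniform.
Variables (R : realType) (m n : nat) (nu x : R).
Hypotheses (m0 : (0 < m)%N) (mn : (m <= n)%N).
Hypotheses (nu0 : 0 < nu) (nu3 : nu ^+ 3 = n%:R).
Local Notation a := (m%:R / nu).
Hypothesis sx : saddle_point a x.
Local Notation X := (x * nu ^+ 2).
Local Notation tau := (x / nu).
Local Notation S := (nu ^+ 2 * (x + x ^- 2 * eta (a * x))).
Local Notation H := (plane_partitions n m).
Local Notation be := (saddle_ratio a x).

Let a0 : 0 < a. Proof. by rewrite divr_gt0 // ltr0n. Qed.
Let x0 : 0 < x. Proof. by have [] := saddle_bounds a0 sx. Qed.
Let X0 : 0 < X. Proof. by rewrite mulr_gt0 // exprn_gt0. Qed.
Let tau0 : 0 < tau. Proof. by rewrite divr_gt0. Qed.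
Let n0 : (0 < n)%N. Proof. exact: leq_trans mn. Qed.
Let t0 : 0 <= a * x. Proof. by rewrite ltW // mulr_gt0. Qed.

Lemma n_tau l : n%:R * (l * tau) = l * X.
Proof. by rewrite -nu3; field; rewrite lt0r_neq0. Qed.

Lemma m_tau l : m%:R * (l * tau) = l * (a * x).
Proof. by field; rewrite lt0r_neq0. Qed.

Lemma saddle_ratioP :
  [/\ 1 / 2 <= be, be <= 1, eta (a * x) = x ^+ 3 * be,
      a * x * eta1 (a * x) = x ^+ 3 * (2 * be - 1) & S = X * (1 + be)].
Proof.
have [_ hx hle _] := saddle_bounds a0 sx.
have x3 : 0 < x ^+ 3 by rewrite exprn_gt0.
have xn : x ^+ 3 != 0 by rewrite lt0r_neq0.
have E : eta (a * x)
  = x ^+ 3 * be by rewrite /saddle_ratio mulrCA mulfV // mulr1.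
split=> //.
- rewrite ler_pdivlMr //; have := mulr_ge0 t0 (eta1_ge0 t0); lra.
- by rewrite ler_pdivrMr // mul1r.
- by rewrite mulrBr mulrCA -E; lra.
- by rewrite {1}E; field; rewrite lt0r_neq0.
Qed.

Lemma exponent_scale (l e : R) : 0 < l ->
  (l * tau) ^- 2 * (x ^+ 3 * e) = X * (e / l ^+ 2).
Proof. by move=> l0; field; rewrite !lt0r_neq0. Qed.

Lemma ln_box_prod_saddle : ln (box_prod m n tau) <= X * be.
Proof.
have [_ _ etaE _ _] := saddle_ratioP.
have := ln_box_prod_le m n tau0.
have mt := m_tau 1; rewrite !mul1r in mt; rewrite mt etaE.
by have := exponent_scale be ltr01; rewrite mul1r expr1n divr1 => ->.
Qed.

Lemma ln_plane_partitions_le : (0 < H)%N -> ln (H%:R : R) <= S.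
Proof.
move: x0 X0 t0 => x0' X0' t0'.
move=> H0; have h := plane_partitions_upper mn tau0.
have HR : 0 < H%:R :> R by rewrite ltr0n.
have e0 : 0 < expR (- tau) ^+ n by rewrite exprn_gt0 // expR_gt0.
have := h; rewrite -ler_ln ?posrE ?mulr_gt0 ?box_prod_gt0 // lnM ?posrE //.
rewrite -expRM_natl expRK mulrN => l1.
have l2 := ln_box_prod_le m n tau0.
have nt := n_tau 1; have mt := m_tau 1; rewrite !mul1r in nt mt.
rewrite nt in l1; rewrite mt in l2.
have -> : S = X + tau ^- 2 * eta (a * x) by field; rewrite !lt0r_neq0.
by lra.
Qed.

(** The exponents are of order at least sqrt n, however small m is: if x < 1/2
    the saddle point equation gives x^2 >= (7/8) a >= 7 / (8 nu). *)
Lemma saddle_size : n%:R / 4 <= X ^+ 2.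
Proof.
move: x0 X0 t0 => x0' X0' t0'.
have [_ _ hle _] := saddle_bounds a0 sx.
have nu1 : 1 <= nu.
  rewrite -(ler_pXn2r (n := 3)) ?nnegrE ?(ltW nu0) // expr1n nu3.
  by rewrite ler1n.
have -> : X ^+ 2 = x ^+ 2 * nu * nu ^+ 3 by ring.
rewrite -nu3 mulrC ler_pM2r ?exprn_gt0 //.
have [x2|x2] := leP (1 / 2) x.
  have : 1 / 4 <= x ^+ 2 by rewrite expr2; nra.
  have : 0 <= x ^+ 2 by rewrite sqr_ge0.
  nra.
have h := le_trans (onesubexpRN_ge_div t0) (le_trans (eta_ge_onesub t0) hle).
have q2 : x ^+ 2 <= 1 / 2 * (1 / 2).
  by rewrite expr2; apply: ler_pM; rewrite ?(ltW x0) ?(ltW x2).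
have x3 : x ^+ 3 <= 1 / 2 * (1 / 2 * (1 / 2)).
  by rewrite exprS; apply: ler_pM; rewrite ?(ltW x0) ?(ltW x2) ?sqr_ge0.
have p : 0 < 1 + a * x by lra.
rewrite ler_pdivrMr // in h.
have h2 : 7 / 8 * (a * x) <= x ^+ 3.
  have : x ^+ 3 * (a * x) <= 1 / 2 * (1 / 2 * (1 / 2)) * (a * x).
    by rewrite ler_wpM2r.
  by lra.
have h3 : 7 / 8 * a <= x ^+ 2.
  by rewrite -(ler_pM2r x0) -exprSr; lra.
have h4 : 1 / nu <= a by rewrite ler_pM2r ?invr_gt0 // ler1n.
have : 1 / nu * nu = 1 by rewrite mul1r mulVf // lt0r_neq0.
have : 7 / 8 * (1 / nu) * nu <= x ^+ 2 * nu.
  by rewrite ler_pM2r //; lra.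
by lra.
Qed.

Variable dl : R.
Hypotheses (dl0 : 0 < dl) (dl1 : dl <= 1).
Hypothesis X_large : (35 / dl) ^+ 2 <= X.
Hypothesis nu_large : 4 * zeta3 R * (8 * zeta32 R / dl ^+ 2) ^+ 2 <= nu.

Let dX : 28 <= X * dl ^+ 2.
Proof.
rewrite -ler_pdivrMr ?exprn_gt0 //; apply: le_trans X_large.
rewrite expr_div_n ler_pM2r ?invr_gt0 ?exprn_gt0 // expr2.
by lra.
Qed.

(** The relative error of [ln_box_prod_ge] at the tilted parameter (1 + dl)
    tau is at most dl^2 / 4; each of the two sources gets one half of it. *)
Lemma box_prod_factor :
  1 - dl ^+ 2 / 4 <= (1 - expR (- ((1 + dl) * X)))
                     * (1 - Num.sqrt ((1 + dl) * tau) * zeta32 R).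
Proof.
move: x0 X0 t0 dl0 dl1 dX => x0' X0' t0' dl0' dl1' dX'.
have d2 : 0 < dl ^+ 2 by rewrite exprn_gt0.
have Z32g := zeta32_ge1 R; have Z3g := zeta3_ge1 R.
have e1 : expR (- ((1 + dl) * X)) <= dl ^+ 2 / 8.
  have h : expR (- ((1 + dl) * X)) <= expR (- X).
    by rewrite ler_expR lerN2 ler_peMl ?(ltW X0) //; lra.
  apply: le_trans h _.
  have g := expR_ge1Dx X;
    have E : expR X * expR (- X) = 1 by rewrite -expRD subrr expR0.
  have e0 := expR_gt0 (- X).
  have : X * expR (- X) <= 1 by nra.
  move: E e0 g dX'; move: (X) (expR X) (expR (- X)) => y f e E e0 g dy h.
  have : 28 * e <= y * dl ^+ 2 * e by rewrite ler_pM2r.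
  have : y * e * dl ^+ 2 <= 1 * dl ^+ 2 by rewrite ler_pM2r.
  by lra.
have e2 : Num.sqrt ((1 + dl) * tau) * zeta32 R <= dl ^+ 2 / 8.
  rewrite -ler_pdivlMr; last by lra.
  have q0 : 0 < dl ^+ 2 / 8 / zeta32 R by rewrite !divr_gt0 //; lra.
  rewrite -[leRHS](gtr0_norm q0) -sqrtr_sqr ler_wsqrtr //.
  have xz := saddle_le a0 sx.
  apply: (@le_trans _ _ (4 * zeta3 R / nu)).
    rewrite mulrA ler_pM2r ?invr_gt0 //.
    have : dl * x <= 1 * x by rewrite ler_pM2r.
    by lra.
  rewrite ler_pdivrMr // [leRHS]mulrC -ler_pdivrMr ?exprn_gt0 //.
  apply: le_trans nu_large.
  by rewrite le_eqVlt; apply/orP; left; apply/eqP; field;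
    rewrite !lt0r_neq0 //; lra.
have z1 : 0 <= Num.sqrt ((1
  + dl) * tau) * zeta32 R by rewrite mulr_ge0 ?sqrtr_ge0 //; lra.
have := expR_ge0 (- ((1 + dl) * X)).
move: e1 e2 z1; move: (expR _) (_ * zeta32 R) => u v u1 v1 v0 u0.
have := mulr_ge0 u0 v0; lra.
Qed.

Let dl01 : 0 <= dl <= 1. Proof. by rewrite ltW. Qed.
Let la0 : 0 < 1 + dl. Proof. by rewrite addr_gt0. Qed.
Let La0 : 0 < 1 + 2 * dl. Proof. by rewrite addr_gt0 // mulr_gt0. Qed.
Let t20 : 0 < (1 + dl) * tau. Proof. by rewrite mulr_gt0. Qed.
Let t30 : 0 < (1 + 2 * dl) * tau. Proof. by rewrite mulr_gt0. Qed.

(** The value at the tilted parameter, from the convexity inequality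
    [eta_scale] at l = 1 + dl. *)
Lemma ln_box_prod_tilt :
  X * ((1 + dl)^-1 - 1 + be - dl ^+ 2 / 4)
    <= ln (box_prod m n ((1 + dl) * tau)).
Proof.
have [be1 be2 etaE eta1E _] := saddle_ratioP.
have h := ln_box_prod_ge m n0 t20; rewrite n_tau m_tau in h.
apply: le_trans h.
have f1 := box_prod_factor; have li := inv1D_ge dl01.
have l1 : 1 <= 1 + dl by rewrite lerDl ltW.
have li1 : (1 + dl)^-1 <= 1 by rewrite invf_le1.
have h2 := eta_scale t0 l1.
rewrite -(mulrA ((1 + dl) * (1 + dl - 1))) eta1E etaE in h2.
have lat : 0 <= (1 + dl) * (a * x) by rewrite mulr_ge0 // ltW.
have e0 := le_trans (onesubexpRN_ge0 lat) (eta_ge_onesub lat).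
have d2 : 0 <= dl ^+ 2 by rewrite sqr_ge0.
have d21 : dl ^+ 2 <= 1 by rewrite expr_le1 // ltW.
have h3 : X * ((1 + dl)^-1 - 1 + be) <=
    ((1 + dl) * tau) ^- 2 * eta ((1 + dl) * (a * x)).
  rewrite (_ : X * _ = ((1 + dl) * tau) ^- 2 *
    ((1 + dl) * (2 - (1 + dl)) * (x ^+ 3 * be)
     + (1 + dl) * (1 + dl - 1) * (x ^+ 3 * (2 * be - 1)))).
    by rewrite ler_wpM2l // invr_ge0 sqr_ge0.
  by move: be => b; field; rewrite !lt0r_neq0.
apply: (@le_trans _ _ ((1 - dl ^+ 2 / 4) * (X * ((1 + dl)^-1 - 1 + be)))).
  move: li1 (X) X0 be2; move: (_^-1) be => i b i1 Y Y0 b1.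
  have : Y * (dl ^+ 2 / 4) * (i - 1 + b) <= Y * (dl ^+ 2 / 4).
    rewrite ler_piMr //; last by lra.
    by rewrite mulr_ge0 ?(ltW Y0) // divr_ge0.
  by lra.
apply: (@le_trans _ _ ((1 - dl ^+ 2 / 4)
    * (((1 + dl) * tau) ^- 2 * eta ((1 + dl) * (a * x))))).
  by rewrite ler_wpM2l // subr_ge0 ler_pdivrMr // mul1r (le_trans d21) // ler1n.
by rewrite ler_wpM2r // mulr_ge0 ?invr_ge0 ?sqr_ge0.
Qed.

(** From the tangent inequality [eta_tangent] at the further parameter (1 + 2
    dl) tau. *)
Lemma ln_box_prod_tilt2 :
  ln (box_prod m n ((1 + 2 * dl) * tau)) <= X * (be - 2 * dl + 8 * dl ^+ 2).
Proof.
have [be1 be2 etaE eta1E _] := saddle_ratioP.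
apply: le_trans (ln_box_prod_le m n t30) _; rewrite m_tau.
apply: (@le_trans _ _ (X * ((be + 2 * dl * (2 * be - 1)) / (1 + 2 * dl) ^+ 2))).
  rewrite -exponent_scale // ler_wpM2l ?invr_ge0 ?sqr_ge0 //.
  have -> : x ^+ 3 * (be + 2 * dl * (2 * be - 1)) =
            x ^+ 3 * be + 2 * dl * (x ^+ 3 * (2 * be - 1)) by ring.
  rewrite -etaE -eta1E.
  have Lat : 0 <= (1 + 2 * dl) * (a * x) by rewrite mulr_ge0 // ltW.
  apply: le_trans (eta_tangent Lat t0) _.
  have -> : (1 + 2 * dl) * (a * x) - a * x = 2 * dl * (a * x) by ring.
  by rewrite -!mulrA.
by rewrite ler_pM2l // tilted_exponent_le // ltW.
Qed.

(** The gain X dl^2 / 4 is at least 7, and exp 7 >= 8. *)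
Lemma box_prod_tail (u : R) :
  u + X * (dl ^+ 2 / 4) <= ln (box_prod m n ((1 + dl) * tau)) ->
  expR u <= box_prod m n ((1 + dl) * tau) / 8.
Proof.
have big : 7 <= X * (dl ^+ 2 / 4).
  by have := dX; rewrite mulrA ler_pdivlMr //; move: (X * _) => y; lra.
move: big; move: (X * _) => y y7 h.
rewrite -[X in X / 8]lnK ?posrE ?box_prod_gt0 //.
apply: (@le_trans _ _ (expR (ln (box_prod m n ((1 + dl) * tau)) - 7))).
  by move: h; rewrite ler_expR; move: (ln _) => z; lra.
rewrite expRD ler_wpM2l ?expR_ge0 // expRN lef_pV2 ?posrE ?expR_gt0 //.
by move: (expR_ge1Dx (7 : R)); move: (expR 7) => z; lra.
Qed.

(** 1 / (1 + dl) - 1 + dl is of second order in dl, and half of it survives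
    the relative error dl^2 / 4. *)
Lemma gain_ge : X * (dl ^+ 2 / 4) <= X * ((1 + dl)^-1 - 1 + dl - dl ^+ 2 / 4).
Proof.
rewrite ler_pM2l //; move: (inv1D_ge dl01);
  move: (dl) (dl ^+ 2) ((1 + dl)^-1) => d q i.
by lra.
Qed.

(** Sizes above n: tilting back from (1 + dl) tau to tau gains dl X, more than
    the exponent loses, by strict convexity. *)
Lemma tail_above : expR (- (((1 + dl) * tau - tau) * n%:R)) * box_prod m n tau
  <= box_prod m n ((1 + dl) * tau) / 8.
Proof.
rewrite -[X in _ * X <= _]lnK ?posrE ?box_prod_gt0 // -expRD.
apply: box_prod_tail.
have -> : ((1 + dl) * tau - tau) * n%:R = n%:R * (dl * tau) by ring.
rewrite n_tau; apply: le_trans ln_box_prod_tilt.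
have := ln_box_prod_saddle; have := gain_ge.
move: (dl) ((1 + dl)^-1) (X) (be) (ln _) => d i Y b l; lra.
Qed.

(** Sizes below (1 - 9 dl) n: the first order terms in dl of the exponents
    cancel, and the factor 1 - 9 dl leaves 9 dl^2, which outweighs the second
    order term 8 dl^2 of [ln_box_prod_tilt2]. *)
Lemma tail_below :
  expR (((1 + 2 * dl) * tau - (1 + dl) * tau) * ((1 - 9 * dl) * n%:R))
    * box_prod m n ((1 + 2 * dl) * tau)
  <= box_prod m n ((1 + dl) * tau) / 8.
Proof.
rewrite -[X in _ * X <= _]lnK ?posrE ?box_prod_gt0 // -expRD.
apply: box_prod_tail.
have -> : ((1 + 2 * dl) * tau - (1 + dl) * tau) * ((1 - 9 * dl) * n%:R) =
  n%:R * (dl * (1 - 9 * dl) * tau) by ring.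
rewrite n_tau; apply: le_trans ln_box_prod_tilt.
have := ln_box_prod_tilt2; have := gain_ge.
have : 0 <= X * dl ^+ 2 by rewrite mulr_ge0 ?sqr_ge0 // ltW.
move: (dl) ((1 + dl)^-1) (X) (be) (ln _) => d i Y b l; lra.
Qed.

Lemma box_prod_le_plane_partitions :
  box_prod m n ((1 + dl) * tau) <=
  4 * n.+1%:R * H%:R * expR (- ((1 + dl) * (1 - 9 * dl) * X)).
Proof.
have l12 : tau <= (1 + dl) * tau by rewrite ler_peMl ?lerDl // ltW.
have l23 : (1 + dl) * tau <= (1 + 2 * dl) * tau.
  by rewrite ler_pM2r // lerD2l ler_peMl ?ler1n // ltW.
have := plane_partitions_lower m0 mn ((1 - 9 * dl) * n%:R) tau0 l12 l23.
have -> : (1 + dl) * tau * ((1 - 9 * dl) * n%:R) =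
          n%:R * ((1 + dl) * (1 - 9 * dl) * tau) by ring.
rewrite n_tau natrM; have := tail_above; have := tail_below.
by lra.
Qed.

(** The two tails take at most half of what [plane_partitions_lower] provides,
    hence H is at least exp (la (1 - 9 dl) X) box_prod / (4 (n + 1)) with la =
    1 + dl, and the exponents add up to S up to a multiple of dl X. *)
Lemma ln_plane_partitions_ge :
  (0 < H)%N /\ S - 19 * dl * X - ln (4 * n.+1%:R) <= ln (H%:R : R).
Proof.
have [_ _ _ _ ->] := saddle_ratioP.
have B0 := box_prod_gt0 m n t20; have main := box_prod_le_plane_partitions.
have n1 : 0 < n.+1%:R :> R by [].
have H0 : (0 < H)%N.
  rewrite lt0n; apply/negP => /eqP H0; move: main.
  by rewrite H0 mulr0 mul0r leNgt B0.
have HR : 0 < H%:R :> R by rewrite ltr0n.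
split=> //; move: main; rewrite -ler_ln ?posrE ?mulr_gt0 ?expR_gt0 //.
rewrite lnM ?posrE ?mulr_gt0 ?expR_gt0 // lnM ?posrE ?mulr_gt0 // expRK.
have := ln_box_prod_tilt.
have i1 : 1 - dl <= (1 + dl)^-1.
  by apply: le_trans (inv1D_ge dl01); rewrite lerDl divr_ge0 ?sqr_ge0.
have : X * (1 - dl) <= X * (1 + dl)^-1 by rewrite ler_pM2l.
have : X * dl ^+ 2 <= X * dl by rewrite ler_pM2l // expr2 ler_piMl // ltW.
have : 0 <= X * dl by rewrite mulr_ge0 // ltW.
move: (dl) ((1 + dl)^-1) (X) (be) => d i Y b; lra.
Qed.

(** The polynomial factor is negligible because X is at least sqrt n / 2. *)
Lemma ln_succ_le : ln (4 * n.+1%:R) <= dl * X.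
Proof.
pose s := Num.sqrt X; have s0 : 0 < s by rewrite sqrtr_gt0.
have sE : s ^+ 2 = X by rewrite sqr_sqrtr // ltW.
have sl : 35 / dl <= s.
  by rewrite -(ler_pXn2r (n := 2)) ?nnegrE ?(ltW s0) ?divr_ge0 ?(ltW dl0) // sE.
have nX : n%:R <= 4 * X ^+ 2 by have := saddle_size;
  rewrite ler_pdivrMr // mulrC.
have n1 : 1 <= n%:R :> R by rewrite ler1n.
have ds : 35 * s <= dl * X.
  rewrite -sE; rewrite ler_pdivrMr // in sl.
  by have -> : dl * s ^+ 2 = s * dl * s; [ring|rewrite ler_pM2r].
have s35 : 35 <= s.
  by apply: le_trans sl; rewrite ler_pdivlMr // ler_piMr.
(* 4 (n + 1) <= 8 n <= 32 X^2 = 32 s^4, and ln 32 + 4 ln s <= 31 + 4 (s - 1) *)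
apply: le_trans ds; apply: (@le_trans _ _ (ln (32 * s ^+ 4))).
  rewrite ler_ln ?posrE ?mulr_gt0 ?exprn_gt0 //.
  have -> : s ^+ 4 = X ^+ 2 by rewrite -sE -exprM.
  by move: nX; rewrite -natr1; move: (X ^+ 2) => y; lra.
rewrite lnM ?posrE ?exprn_gt0 // lnXn //.
have l1 : ln 32 <= 31 :> R.
  by have := @le_ln1Dx R 31; rewrite (_ : 1 + 31 = 32); [apply; lra|lra].
have l2 : ln s <= s - 1.
  by have := @le_ln1Dx R (s - 1); rewrite addrCA subrr addr0; apply; lra.
by move: (ln 32) (ln s) l1 l2 s35 => u v; lra.
Qed.

Lemma uniform_bound :
  `| ln (H%:R : R) / (nu ^+ 2) / (x + x ^- 2 * eta (a * x)) - 1 | <= 20 * dl.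
Proof.
have [H0 lo] := ln_plane_partitions_ge; have up := ln_plane_partitions_le H0.
have [be1 _ _ _ SE] := saddle_ratioP.
have XS : X <= S.
  by rewrite SE ler_peMr ?(ltW X0) // lerDl (le_trans _ be1) // divr_ge0.
have S0 : 0 < S by apply: lt_le_trans XS.
have lnb := ln_succ_le.
have XdS : dl * X <= dl * S by rewrite ler_pM2l.
have -> : ln (H%:R : R) / nu ^+ 2 / (x + x ^- 2 * eta (a * x))
  = ln (H%:R : R) / S.
  by rewrite -(mulrA (ln _)) -invfM.
have q1 : ln (H%:R : R) / S <= 1 by rewrite ler_pdivrMr // mul1r.
have q2 : 1 - 20 * dl <= ln (H%:R : R) / S.
  rewrite ler_pdivlMr //; move: lo lnb XdS.
  move: (dl) (X) (S) => d Y s; lra.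
move: dl0 q1 q2; move: (_ / S) (dl) => q d d0 q1 q2.
by rewrite ler_norml; lra.
Qed.

End Uniform.

Unset Implicit Arguments.

Theorem theorem6p1 (R : realType) :
  (forall a : R, 0 < a -> exists! x : R, saddle_point a x) /\
  forall r : R -> R, (forall a : R, 0 < a -> saddle_point a (r a)) ->
  [/\ (* asymptotics as n -> oo, uniformly as m -> oo and m <= n *)
      forall e : R, 0 < e -> exists N : nat, forall n m : nat,
        (N <= n)%N -> (N <= m)%N -> (m <= n)%N ->
        let alpha : R := m%:R / n%:R `^ (1 / 3) in
        `| ln (plane_partitions n m)%:R / n%:R `^ (2 / 3) / growth r alpha
           - 1 | < e,
      growth r a / (2 * pi / Num.sqrt 6 * Num.sqrt a) @[a --> 0^'+] --> (1 : R)
    & growth r a / (3 * 2 `^ (- (2 / 3)) * zeta 3 `^ (1 / 3)) @[a --> +oo]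
        --> (1 : R)].
Proof.
split=> [a a0|r Hr].
  have [x sx] := saddle_point_ex a0.
  by exists x; split=> // y; exact: saddle_point_uniq.
split; [|exact: growth_cvg0|exact: growth_cvgy].
move=> e e0.
have [dl [dl0 dl1 dle]] : exists dl : R, [/\ 0 < dl, dl <= 1 & 20 * dl < e].
  exists (Num.min 1 e / 40).
  have [h1 h2] : Num.min 1 e <= 1 /\ Num.min 1 e
    <= e by rewrite !ge_min !lexx orbT.
  have h0 : 0 < Num.min 1 e by rewrite lt_min ltr01.
  by split; lra.
(* n >= C1 makes X large through saddle_size, n >= c2^3 makes nu large *)
pose C1 := ((35 / dl) ^+ 2) ^+ 2 * 4.
pose c2 := 4 * zeta3 R * (8 * zeta32 R / dl ^+ 2) ^+ 2.
exists (maxn 1 (Num.truncn (C1 + c2 ^+ 3)).+1) => n m nN mN mn.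
pose alpha : R := m%:R / n%:R `^ (1 / 3);
  rewrite -[let _ := _ in _]/(_ < _) -/alpha.
have m0 : (0 < m)%N by apply: leq_trans mN; rewrite leq_max.
have n0 : (0 < n)%N by exact: leq_trans mn.
have nR : 0 < n%:R :> R by rewrite ltr0n.
have C10 : 0 <= C1 by rewrite mulr_ge0 ?sqr_ge0.
have c20 : 0 <= c2.
  rewrite mulr_ge0 ?sqr_ge0 // mulr_ge0 //.
  by apply: le_trans (zeta3_ge1 R).
have nC : C1 + c2 ^+ 3 <= n%:R.
  apply: (@le_trans _ _ (Num.truncn (C1 + c2 ^+ 3)).+1%:R).
    by apply/ltW/truncnS_gt.
  by rewrite ler_nat; apply: leq_trans nN; rewrite leq_maxr.
have c23 : 0 <= c2 ^+ 3 by apply: exprn_ge0.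
pose nu := n%:R `^ (1 / 3) : R.
have nu0 : 0 < nu by apply: powR_gt0.
have nu3 : nu ^+ 3 = n%:R.
  rewrite -powR_mulrn ?powR_ge0 // -powRrM (_ : 1 / 3 * 3%:R
    = 1) ?powRr1 ?ltW //.
  by field.
have nu2 : n%:R `^ (2 / 3) = nu ^+ 2.
  by rewrite -powR_mulrn ?powR_ge0 // -powRrM; congr (_ `^ _); field.
have a0 : 0 < alpha by rewrite divr_gt0 // ltr0n.
have sx := Hr _ a0.
rewrite nu2 /growth; apply: le_lt_trans dle.
have [x0 _ _ _] := saddle_bounds a0 sx.
apply: uniform_bound => //; last first.
  by rewrite -/c2 -(ler_pXn2r (n := 3)) ?nnegrE ?(ltW nu0) // nu3; lra.
have X0 : 0 <= r alpha * nu ^+ 2 by rewrite mulr_ge0 ?exprn_ge0 // ltW.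
rewrite -(ler_pXn2r (n := 2)) ?nnegrE ?sqr_ge0 //.
apply: le_trans (saddle_size m0 mn nu0 nu3 sx).
by rewrite ler_pdivlMr // -/C1; lra.
Qed.
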